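(* Let $\mu,\nu>0$. There is an absolute constant $\delta>0$ for which the following holds. Let $1<r\le\infty$, $\frac32<\theta\le2$ and $\gamma>\frac32$ with $\theta+\gamma\le4$, and suppose in addition that the triplet $(r,\theta,\gamma)$ satisfies either $$\gamma\le\frac52,\qquad 2\le\theta+\frac3r<3,\qquad \gamma+\frac3r<4,$$ or $$r\ge\frac32,\qquad \theta+\frac3r\ge3,\qquad \gamma+\frac3r<4,\qquad \theta+\gamma+\frac3r\le\frac{11}{2}.$$ Then there exist divergence-free initial data $u_0,b_0\in L^2(\mathbb T^3)$ with $(u_0,b_0)\in B^{\frac3r+\theta-3}_{r,\infty}(\mathbb T^3)\times B^{\frac3r+\gamma-3}_{r,\infty}(\mathbb T^3)$ such that every Leray-Hopf weak solution $(u(t),b(t))$ of the magneto-hydrodynamics (MHD) system on $\mathbb T^3$ with initial data $(u_0,b_0)$ satisfies $$\limsup_{t\to0^+}\left(\|u(t)-u_0\|_{B^{\frac3r+\theta-3}_{r,\infty}}+\|b(t)-b_0\|_{B^{\frac3r+\gamma-3}_{r,\infty}}\right)\ge\delta .$$ (Here $\frac3r=0$ if $r=\infty$.)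
   Context: The incompressible MHD system on the torus $\mathbb T^3$ (functions $2\pi$-periodic in each variable), with parameters $\mu,\nu>0$, is $$u_t-\mu\Delta u+u\cdot\nabla u-b\cdot\nabla b+\nabla p=0,\qquad b_t-\nu\Delta b+u\cdot\nabla b-b\cdot\nabla u=0,\qquad \nabla\cdot u=\nabla\cdot b=0,$$ with initial conditions $u(x,0)=u_0(x)$, $b(x,0)=b_0(x)$, $\nabla\cdot u_0=\nabla\cdot b_0=0$. A Leray-Hopf weak solution with data $(u_0,b_0)\in L^2\times L^2$ is a pair $(u,b)$ of divergence-free fields with $u,b\in L^\infty(0,\infty;L^2)\cap L^2(0,\infty;H^1)$, weakly continuous in time with values in $L^2$, solving the system in the sense of distributions with $u(0)=u_0$, $b(0)=b_0$, and satisfying for all $t>0$ the energy inequality $$\|u(t)\|_{L^2}^2+\|b(t)\|_{L^2}^2+2\int_0^t\left(\mu\|\nabla u(s)\|_{L^2}^2+\nu\|\nabla b(s)\|_{L^2}^2\right)ds\le\|u_0\|_{L^2}^2+\|b_0\|_{L^2}^2 .$$ Besov norm: put $\lambda_q=2^q$. Let $\chi\in C_0^\infty(\mathbb R^3)$ be a nonnegative radial function with $\chi(\xi)=1$ for $|\xi|\le\frac34$ and $\chi(\xi)=0$ for $|\xi|\ge1$. Let $\varphi(\xi)=\chi(\xi/2)-\chi(\xi)$, $\varphi_q(\xi)=\varphi(\lambda_q^{-1}\xi)$ for $q\ge0$, and $\varphi_{-1}=\chi$. For a periodic distribution $v$ with Fourier coefficients $\hat v(k)$, set $v_q(x)=\sum_{k\in\mathbb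 Z^3}\hat v(k)\varphi_q(k)e^{ik\cdot x}$, $q\ge-1$. Then $\|v\|_{B^s_{r,\infty}}=\sup_{q\ge-1}\lambda_q^s\|v_q\|_{L^r}$, and $B^s_{r,\infty}(\mathbb T^3)$ is the space of periodic distributions for which this norm is finite. *)

(* Defs.v *)
From HB Require Import structures.
From mathcomp Require Import all_boot all_order all_algebra.
From mathcomp Require Import complex.
From mathcomp Require Import all_classical all_reals all_analysis.
Import Order.TTheory GRing.Theory Num.Theory.
Import numFieldNormedType.Exports.
Set Implicit Arguments.
Unset Strict Implicit.
Unset Printing Implicit Defensive.

Local Open Scope classical_set_scope.
Local Open Scope ring_scope.

Section Space.
Context {R : realType}.
Local Notation E := (R * R * R)%type.
(* Lebesgue measure is declared on [measurableTypeR R], not on [R] itself, so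
   its products live on [mE], which is convertible to [E]. *)
Local Notation mE :=
  (measurableTypeR R * measurableTypeR R * measurableTypeR R)%type.

Definition basis (i : 'I_3) : E :=
  ((i == 0 :> nat)%:R, (i == 1%N :> nat)%:R, (i == 2%N :> nat)%:R).

Definition dot (x y : E) : R := x.1.1 * y.1.1 + x.1.2 * y.1.2 + x.2 * y.2.

(* The canonical norm of a product is the maximum norm. *)
Definition euclid (x : E) : R := Num.sqrt (dot x x).

Definition periodic (f : E -> R) :=
  forall i x, f (x + (2 * pi) *: basis i) = f x.

Definition cell : set mE :=
  (`[0, 2 * pi]%classic `*` `[0, 2 * pi]%classic) `*` `[0, 2 * pi]%classic.

Lemma measurable_cell : measurable cell.
Proof. by do !apply: measurableX; apply: measurable_itv. Qed.

Definition lebesgue3 : {measure set mE -> \bar R} :=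
  ((lebesgue_measure \x lebesgue_measure) \x lebesgue_measure)%E.

(* Total mass (2 pi)^3.  Functions on the torus are periodic functions on R^3,
   integrated against this measure. *)
Definition torus : {measure set mE -> \bar R} :=
  mrestr lebesgue3 measurable_cell.

Definition L2_fun (f : E -> R) :=
  [/\ periodic f, measurable_fun [set: mE] f &
      (\int[torus]_x (f x ^+ 2)%:E < +oo)%E].

Definition field := 'I_3 -> E -> R.

Definition L2_field (v : field) := forall i, L2_fun (v i).

Definition sqnorm (v : field) : \bar R :=
  (\sum_(i < 3) \int[torus]_x (v i x ^+ 2)%:E)%E.

End Space.
Arguments field : clear implicits.

Section Smooth.
Context {R : realType} {V : normedModType R}.

Definition iter_deriv (s : seq V) (f : V -> R) : V -> R :=
  foldr (fun v (g : V -> R) => fun x => 'D_v g x) f s.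

Definition smooth (f : V -> R) := forall s : seq V,
  continuous (iter_deriv s f) /\ forall x v, derivable (iter_deriv s f) x v.

End Smooth.

Section WeakDerivatives.
Context {R : realType}.
Local Notation E := (R * R * R)%type.
Implicit Types (f g psi : E -> R) (v : field R).

Definition div_free v := forall psi, periodic psi -> smooth psi ->
  \sum_(i < 3) \int[torus]_x (v i x * 'D_(basis i) psi x) = 0.

Definition weak_deriv (j : 'I_3) f g :=
  L2_fun g /\ forall psi, periodic psi -> smooth psi ->
  \int[torus]_x (f x * 'D_(basis j) psi x) = - \int[torus]_x (g x * psi x).

(* [|| grad v ||_{L^2}^2].  A weak derivative is unique almost everywhere, so
   each infimum is over a set with at most one element; it is [+oo] exactly
   when the derivative does not exist in L^2. *)
Definition grad_sqnorm v : \bar R :=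
  (\sum_(i < 3) \sum_(j < 3)
     ereal_inf [set (\int[torus]_x (g x ^+ 2)%:E)%E | g in weak_deriv j (v i)])%E.

End WeakDerivatives.

Section Besov.
Context {R : realType}.
Local Notation E := (R * R * R)%type.
Local Notation K := (int * int * int)%type.
Implicit Types (chi f : E -> R) (v : field R).

Definition besov_cutoff chi :=
  [/\ smooth chi, forall xi, 0 <= chi xi,
      forall xi eta, euclid xi = euclid eta -> chi xi = chi eta,
      forall xi, euclid xi <= 3 / 4 -> chi xi = 1 &
      forall xi, 1 <= euclid xi -> chi xi = 0].

Definition freq (k : K) : E := (k.1.1%:~R, k.1.2%:~R, k.2%:~R).

Definition lambda (q : int) : R := 2 ^ q.

Definition phi chi (xi : E) : R := chi (2^-1 *: xi) - chi xi.

(* Only used for [-1 <= q]. *)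
Definition phi_ chi (q : int) (xi : E) : R :=
  if q == -1 then chi xi else phi chi ((lambda q)^-1 *: xi).

Definition expi (t : R) : R[i] := (cos t +i* sin t)%C.

(* [(2 pi)^-3 \int f(x) exp(- i k.x) dx], split into real and imaginary part. *)
Definition fourier f (k : K) : R[i] :=
  ((2 * pi) ^- 3 * \int[torus]_x (f x * cos (dot (freq k) x))
   +i* - ((2 * pi) ^- 3 * \int[torus]_x (f x * sin (dot (freq k) x))))%C.

(* A sum with finite support, because [phi_ chi q] has bounded support. *)
Definition block chi (q : int) f (x : E) : R[i] :=
  \sum_(k \in [set: K])
    (fourier f k * (phi_ chi q (freq k))%:C * expi (dot (freq k) x))%C.

Definition block_norm chi (q : int) v (x : E) : R :=
  Num.sqrt (\sum_(i < 3) Normc.normc (block chi q (v i) x) ^+ 2).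

(* The norm is applied to square integrable fields only. *)
Definition besov_norm chi (s : R) (r : \bar R) v : \bar R :=
  ereal_sup [set ((lambda q `^ s)%:E * 'N[torus]_r [EFin \o block_norm chi q v])%E
            | q in [set q : int | -1 <= q]].

(* [3 / r], with [3 / +oo = 0]. *)
Definition three_over (r : \bar R) : R := if r is r'%:E then 3 / r' else 0.

End Besov.

Section MHD.
Context {R : realType}.
Local Notation E := (R * R * R)%type.
Implicit Types (f : R * E -> R) (u b : R -> field R).

Definition dt f (z : R * E) : R := 'D_((1, 0) : R * E) f z.
Definition dx (i : 'I_3) f (z : R * E) : R := 'D_((0, basis i) : R * E) f z.
Definition lap f (z : R * E) : R := \sum_(i < 3) dx i (dx i f) z.

(* Test functions on (0, oo) x T^3 whose support is in [a, c] x T^3. *)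
Definition test_on (a c : R) f :=
  [/\ smooth f, forall t, periodic (fun x => f (t, x)) &
      forall t x, ~~ (a <= t <= c) -> f (t, x) = 0].

Definition test f := exists a c, 0 < a /\ test_on a c f.

Definition directions : seq (R * E) :=
  (1, 0) :: [seq (0, basis i) | i <- enum 'I_3].

(* Distributions on (0, oo) x T^3: linear functionals on test functions, of
   finite order on every compact time interval. *)
Definition distribution (p : (R * E -> R) -> R) :=
  (forall (c : R) f g, test f -> test g ->
     p (fun z => c * f z + g z) = c * p f + p g) /\
  (forall a c : R, 0 < a -> exists (C : R) (N : nat), forall f (M : R),
     test_on a c f ->
     (forall s z, (size s <= N)%N -> {subset s <= directions} ->
        `|iter_deriv s f z| <= M) ->
     `|p f| <= C * M).

Definition st_integral (F : R -> E -> R) : R :=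
  \int[lebesgue_measure]_(t in `]0, +oo[) \int[torus]_x F t x.

(* The system in the sense of distributions; the nonlinear terms are in
   divergence form, e.g. [u . grad b_i = \sum_j d_j (u_j b_i)]. *)
Definition mhd_weak (mu nu : R) u b :=
  (exists2 p, distribution p & forall f i, test f ->
     st_integral (fun t x =>
       u t i x * (dt f (t, x) + mu * lap f (t, x))
       + \sum_(j < 3) (u t j x * u t i x - b t j x * b t i x) * dx j f (t, x))
     + p (dx i f) = 0) /\
  (forall f i, test f ->
     st_integral (fun t x =>
       b t i x * (dt f (t, x) + nu * lap f (t, x))
       + \sum_(j < 3) (u t j x * b t i x - b t j x * u t i x) * dx j f (t, x))
     = 0).

(* Weak continuity [0, oo) -> L^2.  It makes [t |-> u t] strongly measurable
   with values in L^2, so all the time integrals below make sense. *)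
Definition weakly_continuous u := forall i psi, L2_fun psi ->
  {within `[0, +oo[, continuous (fun t => \int[torus]_x (u t i x * psi x))}.

Definition Linfty_L2 u := exists M : R,
  \forall t \ae lebesgue_measure, 0 < t -> (sqnorm (u t) <= M%:E)%E.

(* Together with [Linfty_L2], this is [u \in L^2(0, T; H^1)] for all T, with
   a gradient in L^2 up to T = oo.  Square integrability in time of u itself
   is not asked for: the mean of u over the torus is conserved, so that would
   exclude all solutions whose initial mean is not zero. *)
Definition L2_H1 u :=
  (\int[lebesgue_measure]_(t in `]0%R, +oo[) grad_sqnorm (u t) < +oo)%E.

Definition leray_hopf_component (u0 : field R) u :=
  [/\ forall t, 0 <= t -> L2_field (u t) /\ div_free (u t),
      Linfty_L2 u, L2_H1 u, weakly_continuous u &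
      forall i, \forall x \ae torus, u 0 i x = u0 i x].

Definition energy_inequality (mu nu : R) (u0 b0 : field R) u b :=
  forall t : R, 0 < t ->
  (sqnorm (u t) + sqnorm (b t)
   + 2%:E * \int[lebesgue_measure]_(s in `]0%R, t[)
       (mu%:E * grad_sqnorm (u s) + nu%:E * grad_sqnorm (b s))
   <= sqnorm u0 + sqnorm b0)%E.

Definition leray_hopf (mu nu : R) (u0 b0 : field R) u b :=
  [/\ leray_hopf_component u0 u, leray_hopf_component b0 b,
      mhd_weak mu nu u b & energy_inequality mu nu u0 b0 u b].

End MHD.

(* Main.v *)
(** The equations play no role: take [b0 = 0] and a field [u0] whose dyadic
    blocks at the levels [n + 4] satisfy [lambda^s * norm_r >= c] with a fixed
    [c > 0].  A solution satisfies [grad u(t) \in L^2] for some arbitrarily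
    small times t, and at such a time Cauchy-Schwarz makes the blocks of [u(t)]
    so small at high frequency that the blocks of [u(t) - u0] keep the size of
    those of [u0], whence [|u(t) - u0| >= 1] in the Besov norm.

    The block of [u0] at level n is a multiple of a wave packet with [N^3]
    frequencies [k_0 + c], [0 <= c_i < N].  For [s <= 0] it is concentrated
    ([N = 2^n]), which makes [u0] square integrable although s is not positive;
    for [s > 0] it is a single wave ([N = 1]), small enough to be square
    integrable, and [s < 1] suffices to beat [H^1].  Block norms are bounded
    from below by pairing with an averaged Dirichlet kernel whose L^1 norm is
    bounded independently of n and N. *)
From HB Require Import structures.
From mathcomp Require Import all_boot all_order all_algebra.
From mathcomp Require Import complex.
From mathcomp Require Import all_classical all_reals all_analysis.
From mathcomp Require Import measurable_realfun ess_sup_inf zify ring lra.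
Import Order.TTheory GRing.Theory Num.Theory.
Import numFieldNormedType.Exports.
Local Open Scope classical_set_scope.
Local Open Scope ring_scope.
(* Imported last, since MathComp also has a [basis] and a [periodic]. *)
Require Import Defs.
Set Implicit Arguments.
Unset Strict Implicit.
Unset Printing Implicit Defensive.

(** * The measure of the torus *)

(** Exponents: a packet of [N^3] unit waves has sup norm about [N^3] and L^2 norm about [N^(3/2)],
    hence L^r norm about [N^(3-3/r)] when r >= 2; the amplitude makes [lambda^s] times this
    constant. With [N = 2^n] the L^2 norm is then of order [2^(-n(theta - 3/2))], summable as theta
    > 3/2, while the H^1 contribution is smaller than the packet by a factor of order
    [2^(-n(5/2 - theta))], which tends to 0 as theta <= 2. With [N = 1] the two rates are s and 1 -
    s. Concentration makes the L^r norm large compared with the L^2 norm only for r > 2, and s <= 0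
    guarantees this, since then 3/r <= 3 - theta < 3/2. The dual kernel must serve all r > 1 at
    once, including r = oo, where it is measured in L^1; a plain sum of waves over a cube has L^1
    norm growing with [N], hence the averaging. The data are fixed before the solution, but the
    level at which they beat H^1 depends on the gradient at the time that is picked. Infinitely many
    levels in one series resolve this, and the amplitudes are normalised so that the lower bound is
    1 whatever the solution is. *)

Section torus_measure.
Context {R : realType}.
Local Notation mR := (measurableTypeR R).
Local Notation mE := (mR * mR * mR)%type.

Let arc : set mR := `[0, 2 * pi]%classic.

Let measurable_arc : measurable arc. Proof. exact: measurable_itv. Qed.

Definition circle : set mR -> \bar R := mrestr lebesgue_measure measurable_arc.

HB.instance Definition _ := Measure.on circle.

Lemma circleT : circle setT = (2 * pi)%:E.
Proof.
rewrite /circle /mrestr setTI lebesgue_measure_itv/= lte_fin mulr_gt0 ?pi_gt0//.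
by rewrite -EFinB subr0.
Qed.

Let fin_num_circle : fin_num_fun circle.
Proof.
move=> A mA; rewrite ge0_fin_numE// (@le_lt_trans _ _ (circle setT))//.
  by apply: le_measure; rewrite ?inE.
by rewrite circleT ltry.
Qed.

HB.instance Definition _ := @Measure_isFinite.Build _ mR R circle fin_num_circle.

(* The library makes a product measure sigma-finite only when the factors are
   subprobabilities, hence this explicit copy of [circle \x circle]. *)
Definition circle2 : set (mR * mR) -> \bar R := (circle \x circle)%E.

HB.instance Definition _ := Measure.on circle2.

Lemma circle2T : circle2 setT = ((2 * pi) ^+ 2)%:E.
Proof.
by rewrite /circle2 -setXTT product_measure1E//= circleT -EFinM expr2.
Qed.

Let fin_num_circle2 : fin_num_fun circle2.
Proof.
move=> A mA; rewrite ge0_fin_numE// (@le_lt_trans _ _ (circle2 setT))//.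
  by apply: le_measure; rewrite ?inE.
by rewrite circle2T ltry.
Qed.

HB.instance Definition _ :=
  @Measure_isFinite.Build _ (mR * mR)%type R circle2 fin_num_circle2.

(** Both sides agree on rectangles, so uniqueness of product measures applies. The right-hand side
    is a product of finite measures, the form to which Fubini's theorem applies. *)
Lemma torus_circle (A : set mE) : measurable A ->
  torus A = (circle2 \x circle)%E A.
Proof.
move=> mA; have marc2 : measurable (arc `*` arc) by exact: measurableX.
pose m2 : {measure set (mR * mR) -> \bar R} :=
  mrestr (lebesgue_measure \x lebesgue_measure)%E marc2.
have m2E (B : set (mR * mR)) : measurable B -> circle2 B = m2 B.
  apply: (@product_measure_unique _ _ _ _ _ circle circle m2) => C D mC mD.
  rewrite /m2/= /mrestr -setXI.
  by rewrite product_measure1E//; apply: measurableI.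
apply/esym; apply: (@product_measure_unique _ _ _ _ _ circle2 circle torus) => //.
move=> B C mB mC; rewrite [X in (X * _)%E](m2E _ mB).
rewrite /torus/= /mrestr /cell -setXI /m2/= /lebesgue3/=.
by rewrite product_measure1E//; apply: measurableI.
Qed.

Lemma torusT : torus [set: mE] = ((2 * pi) ^+ 3)%:E.
Proof.
rewrite torus_circle// -setXTT product_measure1E//.
rewrite [X in (X * _)%E]circle2T [X in (_ * X)%E]circleT.
by rewrite -!EFinM [in RHS]exprSr.
Qed.

Lemma torus_cellC : torus (~` cell : set mE) = 0%E.
Proof. by rewrite /torus/= /mrestr setICl measure0. Qed.

Lemma ae_torus_cell (P : mE -> Prop) : (forall x, cell x -> P x) ->
  \forall x \ae torus, P x.
Proof.
move=> cellP; exists (~` cell); split.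
- by apply: measurableC; exact: measurable_cell.
- exact: torus_cellC.
- by move=> x nPx /cellP.
Qed.

End torus_measure.

(** * Measurability and integrability on the torus *)

Section torus_integral.
Context {R : realType}.
Local Notation E := (R * R * R)%type.
Local Notation mR := (measurableTypeR R).
Local Notation mE := (mR * mR * mR)%type.

Lemma normM_le_sqrD (a b : R) : `|a * b| <= a ^+ 2 + b ^+ 2.
Proof.
rewrite ler_norml; have := sqr_ge0 (a - b); have := sqr_ge0 (a + b).
have := sqr_ge0 a; have := sqr_ge0 b; rewrite !expr2.
by move=> ? ? ? ?; apply/andP; split; nra.
Qed.

(** The sigma-algebra of [mE] is a product, not Borel by construction. An open set is recovered as a
    countable union of boxes with rational endpoints; this makes continuous functions measurable. *)
Lemma open_measurable3 (A : set E) : open A -> measurable (A : set mE).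
Proof.
move=> oA; pose U := ((rat * rat) * (rat * rat) * (rat * rat))%type.
pose I (p : rat * rat) : set mR := `]ratr p.1, ratr p.2[%classic.
pose box (p : U) : set mE := (I p.1.1 `*` I p.1.2) `*` I p.2.
have -> : A = \bigcup_p (if `[< box p `<=` A >] then box p else set0).
  apply/seteqP; split=> [x Ax|x [p _]]; last first.
    by case: asboolP => // /[apply].
  have [e /= e0 xeA] : nbhs_ball x A by apply/nbhs_ballP; exact: open_nbhs_nbhs.
  have rat_around (y : R) : exists p, I p y /\ forall z, I p z -> ball y e z.
    have lo : y - e < y by rewrite ltrBlDr ltrDl.
    have up : y < y + e by rewrite ltrDl.
    have [q1] := rat_in_itvoo lo; rewrite in_itv/= => /andP[q1e q1y].
    have [q2] := rat_in_itvoo up; rewrite in_itv/= => /andP[yq2 q2e].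
    exists (q1, q2); split=> [|z]; rewrite /I/= in_itv/= ?q1y ?yq2//.
    move=> /andP[q1z zq2]; rewrite /ball/= ltr_norml.
    by apply/andP; split; lra.
  have [p1 [p1x p1e]] := rat_around x.1.1.
  have [p2 [p2x p2e]] := rat_around x.1.2.
  have [p3 [p3x p3e]] := rat_around x.2.
  exists (p1, p2, p3) => //; case: asboolP => [_|]; first by [].
  case=> y [[/= y1 y2] y3]; apply: xeA.
  by split; [split|]; [exact: p1e|exact: p2e|exact: p3e].
apply: countable_bigcupT_measurable => [|p]; first exact: countableP.
case: asboolP => // _.
by do !apply: measurableX; exact: measurable_itv.
Qed.

Lemma continuous_measurable3 (f : E -> R) :
  continuous f -> measurable_fun [set: mE] (f : mE -> mR).
Proof.
move=> cf mT; apply: (measurability _ (RGenOInfty.measurableE R)) => //.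
move=> _ [_ [a ->] <-]; rewrite setTI; apply: open_measurable3.
by move/continuousP : cf; apply; exact: rray_open.
Qed.

Lemma compact_cell : compact (cell : set E).
Proof.
apply: (@compact_setX (R * R)%type R); last exact: segment_compact.
by apply: (@compact_setX R R); exact: segment_compact.
Qed.

Lemma continuous_cell_bounded (f : E -> R) : continuous f ->
  exists M, forall x, cell x -> `|f x| <= M.
Proof.
move=> cf; have : compact (f @` (cell : set E)).
  by apply: continuous_compact; [exact: continuous_subspaceT|exact: compact_cell].
move=> /compact_bounded[M [_ /(_ (M + 1))]]; rewrite ltrDl ltr01 => /(_ isT) h.
by exists (M + 1) => x cx; apply: h; exists x.
Qed.

Lemma integrable_torus_le (f h : mE -> R) : measurable_fun setT f ->
  torus.-integrable setT (EFin \o h) -> (forall x, cell x -> `|f x| <= h x) ->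
  torus.-integrable setT (EFin \o f).
Proof.
move=> mf /integrableP[mh ih] fh; apply/integrableP; split.
  exact/measurable_EFinP.
apply: le_lt_trans ih; apply: ae_ge0_le_integral => //.
- by apply/measurable_EFinP/measurableT_comp.
- by apply: measurableT_comp.
- apply: ae_torus_cell => x cx _; rewrite lee_fin.
  by rewrite (le_trans (fh _ cx))// ler_norm.
Qed.

Lemma integrable_torus_cst (M : R) : torus.-integrable [set: mE] (EFin \o cst M).
Proof.
apply/integrableP; split; first exact/measurable_EFinP.
rewrite [ltLHS](_ : _ = \int[torus]_x cst (`|M|%:E) x)%E//.
by rewrite integral_cst// [X in (_ * X)%E]torusT -EFinM ltry.
Qed.

Lemma integrable_torus_bounded (f : mE -> R) (M : R) : measurable_fun setT f ->
  (forall x, cell x -> `|f x| <= M) -> torus.-integrable setT (EFin \o f).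
Proof.
by move=> mf fM; apply: (integrable_torus_le mf (integrable_torus_cst M)).
Qed.

Lemma integrable_sqr (f : mE -> R) : measurable_fun setT f ->
  (\int[torus]_x (f x ^+ 2)%:E < +oo)%E ->
  torus.-integrable setT (EFin \o (fun x => f x ^+ 2)).
Proof.
move=> mf f2; apply/integrableP; split.
  by apply/measurable_EFinP; exact: measurable_funX.
by under eq_integral do rewrite /= ger0_norm ?sqr_ge0//.
Qed.

Lemma integrable_L2_bounded (f g : mE -> R) (M : R) :
  measurable_fun setT f -> (\int[torus]_x (f x ^+ 2)%:E < +oo)%E ->
  measurable_fun setT g -> (forall x, cell x -> `|g x| <= M) ->
  torus.-integrable setT (EFin \o (fun x => f x * g x)).
Proof.
move=> mf f2 mg gM.
have h : torus.-integrable setT (EFin \o (fun x => f x ^+ 2 + M ^+ 2)).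
  have := integrableD measurableT (integrable_sqr mf f2) (integrable_torus_cst (M ^+ 2)).
  by apply: eq_integrable.
apply: (integrable_torus_le _ h); first exact: measurable_funM.
move=> x /gM gxM; rewrite (le_trans (normM_le_sqrD _ _))// lerD2l.
by rewrite -[g x ^+ 2]real_normK ?num_real// lerXn2r ?nnegrE// (le_trans _ gxM).
Qed.

Lemma integrable_L2M (f g : mE -> R) :
  measurable_fun setT f -> (\int[torus]_x (f x ^+ 2)%:E < +oo)%E ->
  measurable_fun setT g -> (\int[torus]_x (g x ^+ 2)%:E < +oo)%E ->
  torus.-integrable setT (EFin \o (fun x => f x * g x)).
Proof.
move=> mf f2 mg g2.
have h : torus.-integrable setT (EFin \o (fun x => f x ^+ 2 + g x ^+ 2)).
  have := integrableD measurableT (integrable_sqr mf f2) (integrable_sqr mg g2).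
  by apply: eq_integrable.
apply: (integrable_torus_le _ h); first exact: measurable_funM.
by move=> x _; exact: normM_le_sqrD.
Qed.

Lemma integrable_torusZ (C : R) (f : mE -> R) :
  torus.-integrable setT (EFin \o f) ->
  torus.-integrable setT (EFin \o (fun x => C * f x)).
Proof.
by move=> fi; have := integrableZl measurableT C fi; apply: eq_integrable.
Qed.

Lemma integrable_torusD (f g : mE -> R) :
  torus.-integrable setT (EFin \o f) -> torus.-integrable setT (EFin \o g) ->
  torus.-integrable setT (EFin \o (fun x => f x + g x)).
Proof.
by move=> fi gi; have := integrableD measurableT fi gi; apply: eq_integrable.
Qed.

Lemma integrable_torus_sum (I : Type) (s : seq I) (f : I -> mE -> R) :
  (forall i, torus.-integrable setT (EFin \o f i)) ->
  torus.-integrable setT (EFin \o (fun x => \sum_(i <- s) f i x)).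
Proof.
move=> fi; elim: s => [|i s IH].
  have := integrable_torus_cst 0; apply: eq_integrable => // x _.
  by rewrite /= big_nil.
have := integrableD measurableT (fi i) IH; apply: eq_integrable => // x _.
by rewrite /= big_cons.
Qed.

Lemma Rintegral_sum (I : Type) (s : seq I) (f : I -> mE -> R) :
  (forall i, torus.-integrable setT (EFin \o f i)) ->
  \int[torus]_x (\sum_(i <- s) f i x) = \sum_(i <- s) \int[torus]_x f i x.
Proof.
move=> fi; elim: s => [|i s IH].
  under eq_Rintegral do rewrite big_nil.
  by rewrite big_nil Rintegral_cst// mul0r.
rewrite big_cons -IH -RintegralD//; last exact: integrable_torus_sum.
by apply: eq_Rintegral => x _; rewrite big_cons.
Qed.

End torus_integral.

(** * Trigonometric functions and integration by parts *)

Section derivative_integral.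
Context {R : realType}.
Local Notation E := (R * R * R)%type.
Local Notation mR := (measurableTypeR R).
Local Notation mE := (mR * mR * mR)%type.

Lemma continuous_addZ (V : normedModType R) (p v : V) :
  continuous (fun t : R => p + t *: v).
Proof.
move=> t; apply: cvgD; first exact: cvg_cst.
by apply: cvgZr_tmp.
Qed.

Lemma is_derive_line (V : normedModType R) (f : V -> R) (p v : V) (t : R) :
  derivable f (p + t *: v) v ->
  is_derive t 1 (fun s => f (p + s *: v)) ('D_v f (p + t *: v)).
Proof.
have E1 : (fun h : R => h^-1 *: (((fun s => f (p + s *: v)) \o shift t) (h *: 1) - f (p + t *: v)))
    = (fun h : R => h^-1 *: ((f \o shift (p + t *: v)) (h *: v) - f (p + t *: v))).
  apply/funext => h /=; congr (_ *: (f _ - _)).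
  by rewrite scalerDl [h%:A]mulr1 addrCA.
move=> df; apply: DeriveDef.
  by rewrite /derivable E1.
by rewrite /derive E1.
Qed.

Lemma periodicZ (f : E -> R) (i : 'I_3) (n : int) (x : E) : periodic f ->
  f (x + (n%:~R * (2 * pi)) *: basis i) = f x.
Proof.
move=> pf; have pN (m : nat) y : f (y + (m%:R * (2 * pi)) *: basis i) = f y.
  elim: m => [|m IH]; first by rewrite mul0r scale0r addr0.
  by rewrite -natr1 mulrDl mul1r scalerDl addrA pf IH.
case: n => m; first by rewrite -pmulrn pN.
rewrite NegzE mulrNz mulNr scaleNr -pmulrn -[LHS](pN m.+1).
by rewrite subrK.
Qed.

Lemma addZ_basis0 (x1 x2 x3 t : R) :
  (x1, x2, x3) + t *: basis 0 = (x1 + t, x2, x3).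
Proof. by congr (_, _, _); rewrite /= ?scaler0 ?addr0// [t *: _]mulr1. Qed.

Lemma addZ_basis1 (x1 x2 x3 t : R) :
  (x1, x2, x3) + t *: basis 1 = (x1, x2 + t, x3).
Proof. by congr (_, _, _); rewrite /= ?scaler0 ?addr0// [t *: _]mulr1. Qed.

Lemma addZ_basis2 (x1 x2 x3 t : R) :
  (x1, x2, x3) + t *: basis 2 = (x1, x2, x3 + t).
Proof. by congr (_, _, _); rewrite /= ?scaler0 ?addr0// [t *: _]mulr1. Qed.

Lemma periodic_bounded (f : E -> R) : periodic f -> continuous f ->
  exists M, forall x, `|f x| <= M.
Proof.
move=> pf cf; have [M cM] := continuous_cell_bounded cf; exists M => x.
have pi2_gt0 : 0 < 2 * pi :> R by rewrite mulr_gt0 ?pi_gt0.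
have red (y : R) : exists n : int, y + n%:~R * (2 * pi) \in `[0, 2 * pi].
  exists (- Num.floor (y / (2 * pi))); rewrite in_itv/= mulrNz mulNr.
  have := floor_le_tmp (y / (2 * pi)); rewrite ler_pdivlMr// subr_ge0 => ->/=.
  have := lt_succ_floor (y / (2 * pi)); rewrite ltr_pdivrMr// intrD mulrDl mul1r.
  by rewrite lerBlDl => /ltW.
case: x => [[x1 x2] x3].
have [n1 h1] := red x1; have [n2 h2] := red x2; have [n3 h3] := red x3.
rewrite -(periodicZ 0 n1 _ pf) -(periodicZ 1 n2 _ pf) -(periodicZ 2 n3 _ pf).
by apply: cM; rewrite addZ_basis0 addZ_basis1 addZ_basis2.
Qed.

Lemma integral_circle (f : mR -> \bar R) : measurable_fun setT f ->
  (\int[circle]_x f x =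
   \int[lebesgue_measure]_(x in (`[0%R, (2 * pi)%R]%classic : set mR)) f x)%E.
Proof.
move=> mf; set arc := (`[0, 2 * pi]%classic : set mR).
have marc : measurable arc by exact: measurable_itv.
have ge0 (g : mR -> \bar R) : measurable_fun setT g -> (forall x, 0 <= g x)%E ->
  (\int[circle]_x g x = \int[lebesgue_measure]_(x in arc) g x)%E.
  move=> mg g0; rewrite (@ge0_negligible_integral _ _ _ _ _ (~` arc))//; first last.
  - by rewrite [LHS]/(lebesgue_measure (~` arc `&` arc)) setICl measure0.
  - exact: measurableC.
  rewrite setTD setCK; apply: eq_measure_integral => A mA Aarc.
  by rewrite [LHS]/(lebesgue_measure (A `&` arc)) setIidl.
rewrite integralE [RHS]integralE !ge0//.
- exact: measurable_funeneg.
- exact: measurable_funepos.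
Qed.

Lemma integral_circle_primitive0 (F f : R -> R) : continuous f ->
  (forall t : R, is_derive t 1 F (f t)) -> F (2 * pi) = F 0 ->
  (\int[circle]_t (f t)%:E = 0)%E.
Proof.
move=> cf dF F0; have /measurable_EFinP mf := continuous_measurable_fun cf.
rewrite (integral_circle mf).
have cF : continuous F.
  move=> t; apply: differentiable_continuous; apply/derivable1_diffP.
  exact: ex_derive.
have := @continuous_FTC2 R f F 0 (2 * pi); rewrite F0 subee//; apply.
- by rewrite mulr_gt0 ?pi_gt0.
- exact: continuous_subspaceT.
- split => [t _||]; first exact: ex_derive.
    exact: cvg_at_right_filter (cF _).
  exact: cvg_at_left_filter (cF _).
- by move=> t _; rewrite derive1E; exact: derive_val.
Qed.

Lemma integral_circle_derive0 (f : E -> R) (i : 'I_3) (p : E) :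
  periodic f -> (forall x, derivable f x (basis i)) ->
  continuous ('D_(basis i) f) ->
  (\int[circle]_t ('D_(basis i) f (p + (t : R) *: basis i))%:E = 0)%E.
Proof.
move=> pf df cDf.
apply: (@integral_circle_primitive0 (fun t : R => f (p + t *: basis i))).
- move=> t; apply: (@continuous_comp R E R (fun t : R => p + t *: basis i) ('D_(basis i) f)).
    exact: continuous_addZ.
  exact: cDf.
- by move=> t; exact: is_derive_line (df _).
- by rewrite pf scale0r addr0.
Qed.

Lemma periodic_derive (f : E -> R) (v : E) : periodic f -> periodic ('D_v f).
Proof.
move=> pf j x; rewrite /derive; set c := (2 * pi) *: basis j.
have -> // : (fun h : R => h^-1 *: ((f \o shift (x + c)) (h *: v) - f (x + c))) =
  (fun h : R => h^-1 *: ((f \o shift x) (h *: v) - f x)).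
by apply/funext => h /=; rewrite addrA !pf.
Qed.

Lemma integral_torus_circle (f : mE -> \bar R) :
  (\int[torus]_x f x = \int[circle2 \x circle]_x f x)%E.
Proof. by apply: eq_measure_integral => A mA _; exact: torus_circle. Qed.

Lemma bounded_integrable d (T : measurableType d)
    (mu : {finite_measure set T -> \bar R}) (f : T -> R) (M : R) :
  measurable_fun setT f -> (forall x, `|f x| <= M) ->
  mu.-integrable setT (EFin \o f).
Proof.
move=> mf fM; apply: measurable_bounded_integrable => //.
  exact: fin_num_fun_lty.
by exists M; split; [exact: num_real|move=> y My x _; exact/ltW/(le_lt_trans (fM _))].
Qed.

(** Fubini, with the variable of the vanishing line integrals innermost; the three alternatives are
    the three coordinate directions. *)
Lemma integral_torus_line0 (g : mE -> R) (M : R) :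
  measurable_fun setT g -> (forall x, `|g x| <= M) ->
  [\/ forall x y, (\int[circle]_z (g (x, y, z))%:E = 0)%E,
      forall x z, (\int[circle]_y (g (x, y, z))%:E = 0)%E |
      forall y z, (\int[circle]_x (g (x, y, z))%:E = 0)%E] ->
  \int[torus]_x g x = 0.
Proof.
move=> mg gM h; rewrite /Rintegral integral_torus_circle.
have ig : (circle2 \x circle)%E.-integrable setT (EFin \o g).
  apply/integrableP; split; first exact/measurable_EFinP.
  rewrite -integral_torus_circle.
  by have /integrableP[] := integrable_torus_bounded mg (fun x _ => gM x).
have iz z : (circle \x circle)%E.-integrable setT (EFin \o (fun xy => g (xy, z))).
  apply: (@bounded_integrable _ _ circle2 _ M) => //.
  by apply: measurableT_comp => //; exact: measurable_fun_pair.
case: h => h.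
- by rewrite -integral12_prod_meas1// /fubini_F integral0_eq// => -[x y] _; exact: h.
- rewrite -integral21_prod_meas1// /fubini_G integral0_eq// => z _.
  rewrite -[LHS](integral12_prod_meas1 (iz z)) /fubini_F integral0_eq// => x _.
  exact: h.
- rewrite -integral21_prod_meas1// /fubini_G integral0_eq// => z _.
  rewrite -[LHS](integral21_prod_meas1 (iz z)) /fubini_G integral0_eq// => y _.
  exact: h.
Qed.

Lemma integral_torus_derive0 (f : E -> R) (i : 'I_3) :
  periodic f -> (forall x, derivable f x (basis i)) ->
  continuous ('D_(basis i) f) ->
  \int[torus]_x ('D_(basis i) f x) = 0.
Proof.
move=> pf df cDf.
have [M gM] := periodic_bounded (periodic_derive (basis i) pf) cDf.
have mg := continuous_measurable3 cDf.
have line0 (j : 'I_3) (p : E) (h : R -> E) : i = j ->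
    (forall t, h t = p + t *: basis j) ->
    (\int[circle]_t ('D_(basis i) f (h t))%:E = 0)%E.
  move=> <- /funext ->; exact: (integral_circle_derive0 p pf df cDf).
pose g : mE -> R := 'D_(basis i) f; rewrite -[LHS]/(\int[torus]_x g x).
have gM' (x : mE) : `|g x| <= M by exact: gM.
have {}line0 (j : 'I_3) (p : E) (h : R -> E) : i = j ->
    (forall t, h t = p + t *: basis j) -> (\int[circle]_t (g (h t))%:E = 0)%E.
  exact: line0.
have {}mg : measurable_fun setT g by [].
clearbody g; apply: (integral_torus_line0 mg gM').
have [i2|] := eqVneq i 2.
  apply: Or31 => x y; apply: (line0 2 (x, y, 0) (fun t => (x, y, t)) i2) => t.
  by rewrite addZ_basis2 add0r.
have [i1 _|] := eqVneq i 1.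
  apply: Or32 => x z; apply: (line0 1 (x, 0, z) (fun t => (x, t, z)) i1) => t.
  by rewrite addZ_basis1 add0r.
move=> i1 i2; have i0 : i = 0.
  by apply/val_inj; move: (ltn_ord i) i1 i2; rewrite -!val_eqE /=; case: (i : nat) => [|[|[|]]].
apply: Or33 => y z; apply: (line0 0 (0, y, z) (fun t => (t, y, z)) i0) => t.
by rewrite addZ_basis0 add0r.
Qed.

End derivative_integral.

Section waves.
Context {R : realType}.
Local Notation E := (R * R * R)%type.
Local Notation mR := (measurableTypeR R).
Local Notation mE := (mR * mR * mR)%type.
Local Notation K := (int * int * int)%type.
Implicit Types (k l : K) (c d : R) (x v : E).

Lemma dotC x v : dot x v = dot v x.
Proof. by rewrite /dot; congr (_ + _ + _); rewrite mulrC. Qed.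

Lemma dotDr (y x v : E) : dot y (x + v) = dot y x + dot y v.
Proof.
rewrite -[LHS]/(y.1.1 * (x.1.1 + v.1.1) + y.1.2 * (x.1.2 + v.1.2) +
  y.2 * (x.2 + v.2)) /dot; ring.
Qed.

Lemma dotZr (y x : E) (t : R) : dot y (t *: x) = t * dot y x.
Proof.
rewrite -[LHS]/(y.1.1 * (t * x.1.1) + y.1.2 * (t * x.1.2) + y.2 * (t * x.2)) /dot.
ring.
Qed.

Lemma freqD k l : freq (k + l) = freq k + freq l :> E.
Proof. by rewrite /freq /= !intrD. Qed.

Lemma freqN k : freq (- k) = - freq k :> E.
Proof. by rewrite /freq /= !mulrNz. Qed.

Lemma freq0 : freq 0 = 0 :> E.
Proof. by rewrite /freq /= mulr0z. Qed.

(** The free phase keeps sines and derivatives in one family: [c = - (pi / 2)] gives the sine, and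
    differentiation adds [pi / 2] to the phase. *)
Definition wave k c x : R := cos (dot (freq k) x + c).

Definition kcomp k (i : 'I_3) : R := dot (freq k) (basis i).

Lemma kcomp0E k : kcomp k 0 = k.1.1%:~R.
Proof. by rewrite /kcomp /dot/= !mulr0 mulr1 !addr0. Qed.

Lemma kcomp1E k : kcomp k 1 = k.1.2%:~R.
Proof. by rewrite /kcomp /dot/= !mulr0 mulr1 add0r !addr0. Qed.

Lemma kcomp2E k : kcomp k 2 = k.2%:~R.
Proof. by rewrite /kcomp /dot/= !mulr0 mulr1 !add0r. Qed.

Lemma kcomp_neq0 k : k != 0 -> exists i, kcomp k i != 0.
Proof.
move=> k0; apply/not_existsP => h; move: k0; apply/negP; rewrite negbK.
have h0 i : kcomp k i = 0 by apply/eqP; rewrite -[_ == _]negbK; apply/negP/h.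
move: (h0 0) (h0 1) (h0 2); rewrite kcomp0E kcomp1E kcomp2E.
move=> /eqP; rewrite intr_eq0 => /eqP k1 /eqP; rewrite intr_eq0 => /eqP k2.
move=> /eqP; rewrite intr_eq0 => /eqP k3.
by case: k k1 k2 k3 {h h0} => [[? ?] ?] /= -> -> ->.
Qed.

Lemma cosD2piz (t : R) (n : int) : cos (t + n%:~R * (2 * pi)) = cos t.
Proof.
have h (m : nat) s : cos (s + m%:R * (2 * pi)) = cos s :> R.
  elim: m => [|m IH]; first by rewrite mul0r addr0.
  by rewrite -natr1 mulrDl mul1r addrA [X in _ + X](mulr_natl pi 2) cosD2pi IH.
case: n => m; first by rewrite -pmulrn h.
by rewrite NegzE mulrNz mulNr -pmulrn -[LHS](h m.+1) subrK.
Qed.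

Lemma periodic_wave k c : periodic (wave k c).
Proof.
move=> i x; rewrite /wave dotDr dotZr addrAC.
have [n ->] : exists n : int, dot (freq k) (basis i) = n%:~R :> R.
  have := ltn_ord i; rewrite /dot /basis /=.
  case: (i : nat) => [|[|[|]]]//= _; [exists k.1.1|exists k.1.2|exists k.2];
  by rewrite !mulr0 mulr1 ?addr0 ?add0r.
by rewrite mulrC cosD2piz.
Qed.

Lemma is_derive_along (V : normedModType R) (f : V -> R) (x v : V) (d : R) :
  is_derive (0 : R) 1 (fun s : R => f (x + s *: v)) d -> is_derive x v f d.
Proof.
have E1 : (fun h : R => h^-1 *: (((fun s => f (x + s *: v)) \o shift 0) (h *: 1) - f (x + 0 *: v)))
    = (fun h : R => h^-1 *: ((f \o shift x) (h *: v) - f x)).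
  apply/funext => h /=; rewrite scale0r !addr0.
  by rewrite [h%:A]mulr1 [x + _]addrC.
by case=> h1 h2; apply: DeriveDef; rewrite /derivable /derive -E1.
Qed.

Lemma is_derive_wave k c x v :
  is_derive x v (wave k c) (dot (freq k) v * wave k (c + pi / 2) x).
Proof.
apply: is_derive_along; rewrite /wave addrA cosDpihalf.
have -> : (fun s : R => cos (dot (freq k) (x + s *: v) + c)) =
    (fun s => cos ((s * dot (freq k) v) + (dot (freq k) x + c))).
  by apply/funext => s; rewrite dotDr dotZr addrAC addrC.
apply: is_derive_eq.
by rewrite !mul0r /GRing.scale/= add0r; ring.
Qed.

Lemma derive_wave k c v x :
  'D_v (wave k c) x = dot (freq k) v * wave k (c + pi / 2) x.
Proof. by apply: derive_val; exact: is_derive_wave. Qed.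

Lemma continuous_dot (y : E) : continuous (fun x : E => dot y x).
Proof.
move=> x; rewrite /dot.
apply: cvgD; first apply: cvgD.
- by apply: cvgM; [exact: cvg_cst|apply: (cvg_comp fst fst); [exact: cvg_fst|exact: cvg_fst]].
- by apply: cvgM; [exact: cvg_cst|apply: (cvg_comp fst snd); [exact: cvg_fst|exact: cvg_snd]].
- by apply: cvgM; [exact: cvg_cst|exact: cvg_snd].
Qed.

Lemma continuous_wave k c : continuous (wave k c).
Proof.
move=> x; apply: (@continuous_comp E R R (fun x => dot (freq k) x + c) cos).
  by apply: cvgD; [exact: continuous_dot|exact: cvg_cst].
exact: continuous_cos.
Qed.

Lemma measurable_wave k c : measurable_fun [set: mE] (wave k c : mE -> mR).
Proof. by apply: continuous_measurable3; exact: continuous_wave. Qed.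

Lemma wave_le1 k c x : `|wave k c x| <= 1.
Proof. by rewrite ler_norml cos_geN1 cos_le1. Qed.

Lemma is_derive_Zwave (C : R) k c x v :
  is_derive x v (fun y => C * wave k c y)
    (C * (dot (freq k) v * wave k (c + pi / 2) x)).
Proof. have := is_derive_wave k c x v => h; exact: is_deriveZ. Qed.

Lemma smooth_wave k c : smooth (wave k c).
Proof.
move=> s.
have [C [d ->]] : exists C d, iter_deriv s (wave k c) = fun x => C * wave k d x.
  elim: s => [|v s [C [d IH]]]; first by exists 1, c; apply/funext => x/=; rewrite mul1r.
  exists (C * dot (freq k) v), (d + pi / 2); apply/funext => x /=; rewrite IH.
  rewrite -mulrA; have := is_derive_Zwave C k d x v => h; exact: derive_val.
split=> [x|x v].
  by apply: cvgM; [exact: cvg_cst|exact: continuous_wave].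
have := is_derive_Zwave C k d x v => h; exact: ex_derive.
Qed.

End waves.

Section orthogonality.
Context {R : realType}.
Local Notation E := (R * R * R)%type.
Local Notation mR := (measurableTypeR R).
Local Notation mE := (mR * mR * mR)%type.
Local Notation K := (int * int * int)%type.
Implicit Types (k l : K) (c d : R) (x v : E).

Lemma wave0 c x : wave 0 c x = cos c.
Proof. by rewrite /wave freq0 /dot/= !mul0r !addr0 add0r. Qed.

Lemma integrable_wave k c : torus.-integrable setT (EFin \o (wave k c : mE -> R)).
Proof.
by apply: (@integrable_torus_bounded _ _ 1) => [|x _]; [exact: measurable_wave|exact: wave_le1].
Qed.

(** For [k != 0] some [kcomp k i] is nonzero, and [kcomp k i] times the wave is a derivative of a
    periodic function, so its integral vanishes. *)
Lemma integral_wave k c :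
  \int[torus]_x wave k c x = (2 * pi) ^+ 3 * ((k == 0)%:R * cos c).
Proof.
have [->|k0] := eqVneq k 0.
  under eq_Rintegral do rewrite wave0.
  by rewrite Rintegral_cst// [fine _](congr1 fine torusT) mul1r mulrC.
have [i ki] := @kcomp_neq0 R _ k0.
rewrite mul0r mulr0; apply: (mulfI ki); rewrite mulr0.
rewrite -RintegralZl//; last exact: integrable_wave.
have h := @integral_torus_derive0 R (wave k (c - pi / 2)) i (periodic_wave _ _).
rewrite -[RHS]h//.
- apply: eq_Rintegral => x _.
  by rewrite derive_wave subrK.
- by move=> x; apply: ex_derive; exact: is_derive_wave.
- have -> : 'D_(basis i) (wave k (c - pi / 2)) =
      (fun x => kcomp k i * wave k (c - pi / 2 + pi / 2) x).
    by apply/funext => x; rewrite derive_wave.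
  move=> x; apply: cvgM; first exact: cvg_cst.
  exact: continuous_wave.
Qed.

Lemma waveM k l c d x : wave k c x * wave l d x =
  2^-1 * (wave (k + l) (c + d) x + wave (k - l) (c - d) x).
Proof.
rewrite /wave freqD freqD freqN.
have -> : dot (freq k + freq l) x + (c + d) = (dot (freq k) x + c) + (dot (freq l) x + d).
  by rewrite dotC dotDr !(dotC x); ring.
have -> : dot (freq k - freq l) x + (c - d) = (dot (freq k) x + c) - (dot (freq l) x + d).
  by rewrite dotC dotDr -scaleN1r dotZr !(dotC x); ring.
move: (dot (freq k) x + c) (dot (freq l) x + d) => a b.
by rewrite cosD cosB; field.
Qed.

(** Real waves at [k] and [- k] coincide up to phase, hence two resonances; families of frequencies
    without opposite pairs keep only the diagonal one. *)
Lemma integral_waveM k l c d :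
  \int[torus]_x (wave k c x * wave l d x) =
  (2 * pi) ^+ 3 / 2 * ((k + l == 0)%:R * cos (c + d) + (k == l)%:R * cos (c - d)).
Proof.
under eq_Rintegral do rewrite waveM.
rewrite RintegralZl//; last first.
  have := integrableD measurableT (integrable_wave (k + l) (c + d)) (integrable_wave (k - l) (c - d)).
  exact: eq_integrable.
rewrite RintegralD//; try exact: integrable_wave.
rewrite !integral_wave subr_eq0; ring.
Qed.

Lemma integrable_wave_wave k l c d :
  torus.-integrable setT (EFin \o ((fun x => wave k c x * wave l d x) : mE -> R)).
Proof.
apply: (@integrable_torus_bounded _ _ 1) => [|x _].
  by apply: measurable_funM; exact: measurable_wave.
by rewrite normrM mulr_ile1// wave_le1.
Qed.

Lemma integrable_waveM (f : mE -> R) k c :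
  measurable_fun setT f -> (\int[torus]_x (f x ^+ 2)%:E < +oo)%E ->
  torus.-integrable setT (EFin \o (fun x => f x * wave k c x)).
Proof.
move=> mf f2; apply: (@integrable_L2_bounded _ _ _ 1) => //.
  exact: measurable_wave.
by move=> x _; exact: wave_le1.
Qed.

Lemma wave_by_parts (f : E -> R) k c (i : 'I_3) :
  periodic f -> continuous f -> (forall x, derivable f x (basis i)) ->
  continuous ('D_(basis i) f) ->
  \int[torus]_x (wave k c x * 'D_(basis i) f x) =
  - (kcomp k i * \int[torus]_x (wave k (c + pi / 2) x * f x)).
Proof.
move=> pf cf df cDf; pose g : E -> R := wave k c * f.
have dg x : is_derive x (basis i) g
    (wave k c x * 'D_(basis i) f x + kcomp k i * (wave k (c + pi / 2) x * f x)).
  have h1 := is_derive_wave k c x (basis i).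
  have h2 : is_derive x (basis i) f ('D_(basis i) f x) by exact: derivableP.
  apply: is_derive_eq; rewrite /GRing.scale/= /kcomp; ring.
have Dg : 'D_(basis i) g = fun x => wave k c x * 'D_(basis i) f x +
    kcomp k i * (wave k (c + pi / 2) x * f x).
  by apply/funext => x; apply: derive_val.
have i1 : torus.-integrable setT (EFin \o ((fun x => wave k c x * 'D_(basis i) f x) : mE -> R)).
  have [M fM] := continuous_cell_bounded cDf.
  apply: (@integrable_torus_bounded _ _ M) => [|x /fM].
    by apply: measurable_funM; [exact: measurable_wave|exact: continuous_measurable3].
  rewrite normrM; apply: le_trans; rewrite ler_piMl//; exact: wave_le1.
have i2 : torus.-integrable setT (EFin \o ((fun x => wave k (c + pi / 2) x * f x) : mE -> R)).
  have [M fM] := continuous_cell_bounded cf.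
  apply: (@integrable_torus_bounded _ _ M) => [|x /fM].
    by apply: measurable_funM; [exact: measurable_wave|exact: continuous_measurable3].
  rewrite normrM; apply: le_trans; rewrite ler_piMl//; exact: wave_le1.
have := @integral_torus_derive0 R g i; rewrite Dg => h.
apply/eqP; rewrite -subr_eq0 opprK -RintegralZl// -RintegralD//; last first.
  exact: integrable_torusZ.
apply/eqP; apply: h.
- by move=> j x; rewrite /g /GRing.mul/= pf (periodic_wave k c j x).
- by move=> x; apply: ex_derive.
- move=> x; apply: cvgD; apply: cvgM; [exact: continuous_wave|exact: cDf|exact: cvg_cst|].
  by apply: cvgM; [exact: continuous_wave|exact: cf].
Qed.

End orthogonality.

(** * Littlewood-Paley blocks *)

Section blocks.
Context {R : realType}.
Local Notation E := (R * R * R)%type.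
Local Notation mR := (measurableTypeR R).
Local Notation mE := (mR * mR * mR)%type.
Local Notation K := (int * int * int)%type.
Implicit Types (k l : K) (c d : R) (x v : E) (q : int).

Lemma dot_ge0 x : 0 <= dot x x.
Proof. by rewrite /dot -!expr2 !addr_ge0// sqr_ge0. Qed.

Lemma euclidZ (t : R) x : euclid (t *: x) = `|t| * euclid x.
Proof.
by rewrite /euclid dotZr dotC dotZr mulrA -expr2 sqrtrM ?sqr_ge0// sqrtr_sqr.
Qed.

Lemma euclidN x : euclid (- x) = euclid x.
Proof. by rewrite -scaleN1r euclidZ normrN1 mul1r. Qed.

Lemma coord_le_euclid x : [/\ `|x.1.1| <= euclid x, `|x.1.2| <= euclid x & `|x.2| <= euclid x].
Proof.
have h (t : R) : t ^+ 2 <= dot x x -> `|t| <= euclid x.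
  by move=> tx; rewrite -sqrtr_sqr ler_sqrt// dot_ge0.
have := sqr_ge0 x.1.1; have := sqr_ge0 x.1.2; have := sqr_ge0 x.2.
by move=> ? ? ?; split; apply: h; rewrite /dot -!expr2; lra.
Qed.

Lemma lambda_gt0 q : 0 < lambda q :> R.
Proof. by rewrite /lambda exprz_gt0. Qed.

Lemma euclid_dilate q x : euclid ((lambda q)^-1 *: x) = euclid x / lambda q.
Proof. by rewrite euclidZ ger0_norm ?invr_ge0 1?ltW ?lambda_gt0 1?mulrC. Qed.

Lemma euclid_dilate2 q x :
  euclid (2^-1 *: ((lambda q)^-1 *: x)) = euclid x / (2 * lambda q).
Proof. by rewrite euclidZ euclid_dilate ger0_norm ?invr_ge0// mulrCA -invfM. Qed.

Lemma lambda_lt q q' : q < q' -> 2 * lambda q <= lambda q' :> R.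
Proof.
move=> qq'; rewrite /lambda.
have -> : 2 * 2 ^ q = 2 ^ (1 + q) :> R by rewrite expfzDr ?pnatr_eq0.
by rewrite ler_weXz2l ?ler1n//; lia.
Qed.

Variable chi : E -> R.
Hypothesis hchi : besov_cutoff chi.

Let chi1 x : euclid x <= 3 / 4 -> chi x = 1.
Proof. by case: hchi => _ _ _ + _; apply. Qed.

Let chi0 x : 1 <= euclid x -> chi x = 0.
Proof. by case: hchi => _ _ _ _; apply. Qed.

Lemma phi_even q k : phi_ chi q (freq (- k)) = phi_ chi q (freq k).
Proof.
case: hchi => _ _ rad _ _; rewrite freqN /phi_ /phi.
by case: ifP => _; rewrite ?scalerN; first exact/rad/euclidN;
  congr (_ - _); apply/rad/euclidN.
Qed.

(** After dilation the outer cutoff is evaluated at length at most 3/4, where it is 1, and the inner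
    one at length at least 1, where it is 0. Frequencies placed in this annulus pass through the
    block unchanged. *)
Lemma phi_self q x : 0 <= q -> lambda q <= euclid x <= 3 / 2 * lambda q ->
  phi_ chi q x = 1.
Proof.
move=> q0 /andP[lx xl]; rewrite /phi_ gt_eqF; last by lia.
have l0 := lambda_gt0 q.
rewrite /phi chi1 ?chi0 ?subr0//.
  by rewrite euclid_dilate ler_pdivlMr// mul1r.
rewrite euclid_dilate2.
rewrite ler_pdivrMr ?mulr_gt0//.
by apply: le_trans xl _; lra.
Qed.

(** A higher level has both cutoffs equal to 1 on the annulus, because
    [3 / 2 * lambda q <= 3 / 4 * lambda q']; a lower one has both equal to 0, because
    [2 * lambda q' <= lambda q]. *)
Lemma phi_other q q' x : 0 <= q -> -1 <= q' -> q' != q ->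
  lambda q <= euclid x <= 3 / 2 * lambda q -> phi_ chi q' x = 0.
Proof.
move=> q0 q'1 qq' /andP[lx xl]; rewrite /phi_.
have l0 := lambda_gt0 q; have l'0 := lambda_gt0 q'.
case: eqVneq => [_|q'n1].
  apply: chi0; apply: le_trans lx; rewrite /lambda.
  by rewrite -[leLHS](expr0z (2 : R)) ler_weXz2l ?ler1n.
rewrite /phi; have [qltq'|q'leq] := ltP q q'.
  have ll := lambda_lt qltq'.
  rewrite !chi1 ?subrr//.
    rewrite euclid_dilate ler_pdivrMr//; lra.
  rewrite euclid_dilate2.
  rewrite ler_pdivrMr ?mulr_gt0//; lra.
have ll : 2 * lambda q' <= lambda q :> R by apply: lambda_lt; rewrite lt_neqAle qq'.
rewrite !chi0 ?subrr//.
  rewrite euclid_dilate ler_pdivlMr//; lra.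
rewrite euclid_dilate2.
rewrite ler_pdivlMr ?mulr_gt0//; lra.
Qed.

Lemma phi_support q : exists2 s : seq K, uniq s &
  forall k, phi_ chi q (freq k) != 0 -> k \in s.
Proof.
(* The dilated [phi] vanishes beyond [2 * lambda q]; the added 1 covers the block [q = -1], given by
   [chi] itself, which vanishes beyond 1. *)
pose n := Num.bound (2 * lambda q + 1 : R).
have hn : (2 * lambda q + 1 : R) < n%:R.
  by apply: archi_boundP; rewrite addr_ge0// mulr_ge0// ltW ?lambda_gt0.
pose J := [seq (i%:Z - n%:Z)%R | i <- iota 0 (n + n).+1].
have inJ (i : int) : `|i%:~R : R| < n%:R -> i \in J.
  rewrite ltr_norml -[n%:R]/(n%:Z%:~R) -mulrNz !ltr_int => /andP[h1 h2].
  apply/mapP; exists (absz (i + n%:Z)%R); first by rewrite mem_iota; lia.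
  lia.
clearbody J; exists (undup [seq (p, i3) | p <- [seq (i1, i2) | i1 <- J, i2 <- J], i3 <- J]).
  exact: undup_uniq.
move=> k hk; rewrite mem_undup.
have l0 := lambda_gt0 q.
have kn : euclid (freq k : E) < n%:R.
  rewrite ltNge; apply/negP => nk; move: hk; rewrite /phi_ /phi.
  have kl : 2 * lambda q + 1 <= euclid (freq k : E) by apply: le_trans nk; exact: ltW.
  case: ifP => _; first by rewrite chi0 ?eqxx//; lra.
  rewrite !chi0 ?subrr ?eqxx//.
    rewrite euclid_dilate ler_pdivlMr//; lra.
  rewrite euclid_dilate2.
  rewrite ler_pdivlMr ?mulr_gt0//; lra.
have [k1 k2 k3] := coord_le_euclid (freq k).
have m1 := inJ _ (le_lt_trans k1 kn); have m2 := inJ _ (le_lt_trans k2 kn).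
have m3 := inJ _ (le_lt_trans k3 kn).
case: k m1 m2 m3 {hk kn k1 k2 k3} => [[a b] c] m1 m2 m3.
by apply: allpairs_f => //; apply: allpairs_f.
Qed.

End blocks.

Section block_formulas.
Context {R : realType}.
Local Notation E := (R * R * R)%type.
Local Notation mR := (measurableTypeR R).
Local Notation mE := (mR * mR * mR)%type.
Local Notation K := (int * int * int)%type.
Implicit Types (k l : K) (c d : R) (x v : E) (q : int).

(** Unnormalised Fourier coefficient: the phases 0 and [- (pi / 2)] give the cosine and sine parts
    of [fourier]. *)
Definition coef (f : E -> R) k c : R := \int[torus]_x (f x * wave k c x).

Lemma cos_wave k x : cos (dot (freq k) x) = wave k 0 x :> R.
Proof. by rewrite /wave addr0. Qed.

Lemma sin_wave k x : sin (dot (freq k) x) = wave k (- (pi / 2)) x :> R.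
Proof. by rewrite /wave cosBpihalf. Qed.

Lemma fourierE (f : E -> R) k : fourier f k =
  ((2 * pi) ^- 3 * coef f k 0 +i* - ((2 * pi) ^- 3 * coef f k (- (pi / 2))))%C.
Proof.
rewrite /fourier /coef; congr (_ * _ +i* - (_ * _))%C; apply: eq_Rintegral => x _.
  by rewrite cos_wave.
by rewrite sin_wave.
Qed.

Lemma waveN k x : wave (- k) 0 x = wave k 0 x :> R.
Proof.
by rewrite /wave !addr0 freqN dotC -scaleN1r dotZr mulN1r cosN dotC.
Qed.

Lemma waveNs k x : wave (- k) (- (pi / 2)) x = - wave k (- (pi / 2)) x :> R.
Proof. by rewrite -!sin_wave freqN dotC -scaleN1r dotZr mulN1r sinN dotC. Qed.

Lemma sum_delta (s : seq K) (F : K -> R) l : uniq s -> (l \notin s -> F l = 0) ->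
  \sum_(k <- s) F k * (k == l)%:R = F l.
Proof.
move=> us Fl; have [ls|/[dup] /Fl -> lns] := boolP (l \in s).
  rewrite (bigD1_seq l)//= eqxx mulr1 big1 ?addr0// => k /negbTE ->.
  by rewrite mulr0.
rewrite big_seq big1// => k ks; case: eqVneq => [kl|]; last by rewrite mulr0.
by move: lns; rewrite -kl ks.
Qed.

Variable chi : E -> R.
Hypothesis hchi : besov_cutoff chi.

Lemma block_sumE q (s : seq K) : uniq s ->
  (forall k, phi_ chi q (freq k) != 0 -> k \in s) -> forall (f : E -> R) x,
  block chi q f x =
  ((\sum_(k <- s) phi_ chi q (freq k) * (2 * pi) ^- 3 *
      (coef f k 0 * wave k 0 x + coef f k (- (pi / 2)) * wave k (- (pi / 2)) x)) +i*
   (\sum_(k <- s) phi_ chi q (freq k) * (2 * pi) ^- 3 *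
      (coef f k 0 * wave k (- (pi / 2)) x - coef f k (- (pi / 2)) * wave k 0 x)))%C.
Proof.
move=> us hs f x; rewrite /block -(fsbig_widen [set` s])//; last first.
  move=> k [_ /= ks]; have /eqP -> : phi_ chi q (freq k) == 0.
    by apply: contraNT (introN idP ks); exact: hs.
  by rewrite mulr0 mul0r.
rewrite -fsbig_seq//=.
elim: s {us hs} => [|k s IH]; first by rewrite !big_nil.
rewrite !big_cons IH fourierE /expi cos_wave sin_wave.
by apply/eqP; rewrite eq_complex /=; apply/andP; split; apply/eqP; ring.
Qed.

Lemma eq_block q (f g : E -> R) x :
  (forall k c, phi_ chi q (freq k) != 0 -> coef f k c = coef g k c) ->
  block chi q f x = block chi q g x.
Proof.
move=> fg; have [s us hs] := phi_support hchi q.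
rewrite !(block_sumE us hs); congr (_ +i* _)%C; apply: eq_bigr => k _.
  have [->|p0] := eqVneq (phi_ chi q (freq k)) 0; first by rewrite !mul0r.
  by rewrite !fg.
have [->|p0] := eqVneq (phi_ chi q (freq k)) 0; first by rewrite !mul0r.
by rewrite !fg.
Qed.

Lemma block0 q x : block chi q (fun=> 0) x = 0.
Proof.
have [s us hs] := phi_support hchi q.
have c0 k c : coef (fun=> 0) k c = 0.
  rewrite /coef; under eq_Rintegral do rewrite mul0r.
  by rewrite Rintegral_cst// mul0r.
rewrite (block_sumE us hs) !big1// => k _; rewrite !c0 !mul0r ?addr0 ?subr0 ?mulr0//.
Qed.

Lemma coef_waves (I : finType) (a : I -> R) (m : I -> K) k c :
  coef (fun x => \sum_i a i * wave (m i) 0 x) k c =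
  (2 * pi) ^+ 3 / 2 * (cos c * \sum_i a i * ((k == m i)%:R + (k == - m i)%:R)).
Proof.
rewrite /coef; under eq_Rintegral.
  move=> x _; rewrite mulr_suml.
  under eq_bigr do rewrite -mulrA.
  over.
rewrite Rintegral_sum => [|i]; last first.
  exact/integrable_torusZ/integrable_wave_wave.
rewrite !mulr_sumr; apply: eq_bigr => i _.
rewrite RintegralZl//; last exact: integrable_wave_wave.
rewrite integral_waveM add0r sub0r cosN (eq_sym (m i)) addr_eq0 [_ == - k]eq_sym.
rewrite -[k == - m i]eqr_oppLR; ring.
Qed.

Lemma coef_waves0 (I : finType) (a : I -> R) (m : I -> K) k :
  coef (fun x => \sum_i a i * wave (m i) 0 x) k 0 =
  (2 * pi) ^+ 3 / 2 * \sum_i a i * ((k == m i)%:R + (k == - m i)%:R).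
Proof. by rewrite coef_waves cos0 mul1r. Qed.

Lemma coef_wavess (I : finType) (a : I -> R) (m : I -> K) k :
  coef (fun x => \sum_i a i * wave (m i) 0 x) k (- (pi / 2)) = 0.
Proof. by rewrite coef_waves cosN cos_pihalf mul0r mulr0. Qed.

(** A cosine wave is shared evenly between the frequencies [m i] and [- m i]. Since [phi_] is even,
    the two halves recombine in the real part, and the sines in the imaginary part cancel. *)
Lemma block_waves q (I : finType) (a : I -> R) (m : I -> K) x :
  block chi q (fun y => \sum_i a i * wave (m i) 0 y) x =
  (\sum_i a i * phi_ chi q (freq (m i)) * wave (m i) 0 x)%:C%C.
Proof.
have [s us hs] := phi_support hchi q.
have pi3 : (2 * pi) ^+ 3 != 0 :> R by rewrite expf_neq0// mulf_neq0// gt_eqF// pi_gt0.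
have hs0 (l : K) : l \notin s -> phi_ chi q (freq l) = 0.
  by move=> ls; apply/eqP; apply: contraNT ls; exact: hs.
rewrite (block_sumE us hs); congr (_ +i* _)%C.
  rewrite (eq_bigr (fun k => \sum_i a i / 2 *
     (phi_ chi q (freq k) * wave k 0 x * (k == m i)%:R +
      phi_ chi q (freq k) * wave k 0 x * (k == - m i)%:R))); last first.
    move=> k _; rewrite coef_waves0 coef_wavess mul0r addr0.
    move: ((2 * pi) ^+ 3) pi3 => P P0.
    by rewrite !mulr_sumr !mulr_suml !mulr_sumr; apply: eq_bigr => i _; field.
  rewrite exchange_big/=; apply: eq_bigr => i _.
  rewrite -mulr_sumr big_split/= !sum_delta// ?(phi_even hchi) ?waveN; last 2 first.
  - by move=> /hs0; rewrite ?(phi_even hchi) => ->; rewrite mul0r.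
  - by move=> /hs0; rewrite ?(phi_even hchi) => ->; rewrite mul0r.
  by field.
rewrite (eq_bigr (fun k => \sum_i a i / 2 *
   (phi_ chi q (freq k) * wave k (- (pi / 2)) x * (k == m i)%:R +
    phi_ chi q (freq k) * wave k (- (pi / 2)) x * (k == - m i)%:R))); last first.
  move=> k _; rewrite coef_waves0 coef_wavess mul0r subr0.
  move: ((2 * pi) ^+ 3) pi3 => P P0.
  by rewrite !mulr_sumr !mulr_suml !mulr_sumr; apply: eq_bigr => i _; field.
rewrite exchange_big/= big1// => i _.
rewrite -mulr_sumr big_split/= !sum_delta// ?(phi_even hchi) ?waveNs; last 2 first.
- by move=> /hs0; rewrite ?(phi_even hchi) => ->; rewrite mul0r.
- by move=> /hs0; rewrite ?(phi_even hchi) => ->; rewrite mul0r.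
by ring.
Qed.

End block_formulas.

(** * Interpolation and duality for Lebesgue norms *)

Section lp_bounds.
Context {R : realType}.
Local Notation E := (R * R * R)%type.
Local Notation mR := (measurableTypeR R).
Local Notation mE := (mR * mR * mR)%type.
Implicit Types (f g h : mE -> R).

(** Pointwise, [|f| ^ p <= A ^ (p - s) * |f| ^ s]. The case [s = 2] serves the concentrated packets,
    the case [s = 1] the single waves and the dual kernel. *)
Lemma Lnorm_interpolation f (p s A B : R) : 0 < s <= p ->
  measurable_fun setT f -> (forall x, `|f x| <= A) ->
  (\int[torus]_x (`|f x| `^ s)%:E <= B%:E)%E ->
  ('N[torus]_p%:E [EFin \o f] <= (A `^ (1 - s / p) * B `^ p^-1)%:E)%E.
Proof.
move=> /andP[s0 sp] mf fA fB; have p0 : 0 < p by exact: lt_le_trans sp.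
have A0 : 0 <= A by exact: le_trans (fA (0, 0, 0)).
have B0 : 0 <= B.
  by rewrite -lee_fin; apply: le_trans fB; apply: integral_ge0 => x _; rewrite lee_fin powR_ge0.
have mfp (t : R) : measurable_fun setT (fun x => `|f x| `^ t).
  apply: (@measurableT_comp _ _ _ _ _ _ (@powR R ^~ t)) => //.
  exact: measurableT_comp.
rewrite unlock /Lnorm.
have -> : (A `^ (1 - s / p) * B `^ p^-1)%:E = ((A `^ (p - s) * B)%:E `^ p^-1)%E.
  rewrite poweR_EFin powRM ?powR_ge0// -powRrM; congr (_ `^ _ * _)%:E.
  by rewrite mulrBl divff// gt_eqF.
apply: gt0_ler_poweR; first by rewrite invr_ge0 ltW.
- rewrite in_itv/= leey andbT; apply: integral_ge0 => x _.
  by rewrite lee_fin powR_ge0.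
- by rewrite in_itv/= leey andbT lee_fin mulr_ge0 ?powR_ge0.
apply: (@le_trans _ _ (\int[torus]_x ((A `^ (p - s))%:E * (`|f x| `^ s)%:E)))%E.
  apply: ge0_le_integral => //=.
  - by apply/measurable_EFinP; exact: mfp.
  - by apply/measurable_EFinP; apply: measurable_funM => //; exact: mfp.
  - move=> x _; rewrite -EFinM lee_fin.
    have -> : `|f x| `^ p = `|f x| `^ (p - s) * `|f x| `^ s.
      by rewrite -powRD subrK// gt_eqF.
    by rewrite ler_wpM2r ?powR_ge0// ge0_ler_powR ?nnegrE// subr_ge0.
rewrite ge0_integralZl//; last 2 first.
- by apply/measurable_EFinP; exact: mfp.
- by rewrite lee_fin powR_ge0.
by rewrite EFinM lee_wpmul2l// lee_fin powR_ge0.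
Qed.

Lemma Lnormy_le f (A : R) : (forall x, `|f x| <= A) ->
  ('N[torus]_+oo [EFin \o f] <= A%:E)%E.
Proof.
move=> fA; have A0 : 0 <= A by exact: le_trans (fA (0, 0, 0)).
rewrite unlock /Lnorm; case: ifP => _; last by rewrite lee_fin.
by apply/ess_supP; apply: nearW => x /=; rewrite lee_fin.
Qed.

(** Hoelder's inequality, with the dual norm of [g] interpolated between L^1 and L^oo;
    [three_over r / 3] is 1/r, also for r = oo. The majorant [f] of [h] allows one component of a
    field to be paired while the norm is that of the whole field. *)
Lemma Lnorm_duality (r : \bar R) h f g (A B : R) : (1 < r)%E ->
  measurable_fun setT h -> measurable_fun setT f -> measurable_fun setT g ->
  torus.-integrable setT (EFin \o (fun x => h x * g x)) ->
  (forall x, `|h x| <= f x) ->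
  (forall x, `|g x| <= A) -> (\int[torus]_x `|g x|%:E <= B%:E)%E ->
  (`|\int[torus]_x (h x * g x)|%:E <=
   'N[torus]_r [EFin \o f] * (A `^ (three_over r / 3) * B `^ (1 - three_over r / 3))%:E)%E.
Proof.
move=> r1 mh mf mg ihg hf gA gB.
have A0 : 0 <= A by exact: le_trans (gA (0, 0, 0)).
have B0 : 0 <= B.
  by rewrite -lee_fin; apply: le_trans gB; apply: integral_ge0 => x _; rewrite lee_fin.
apply: (@le_trans _ _ (\int[torus]_x `|f x * g x|%:E)%E).
  rewrite EFin_normr_Rintegral//.
  apply: le_trans (le_abse_integral torus measurableT _) _.
    by apply/measurable_EFinP; exact: measurable_funM.
  apply: ge0_le_integral => //=.
  - by apply/measurable_EFinP; apply: measurableT_comp => //; exact: measurable_funM.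
  - by apply/measurable_EFinP; apply: measurableT_comp => //; exact: measurable_funM.
  - move=> x _; rewrite lee_fin !normrM ler_wpM2r//.
    by rewrite (le_trans (hf x))// ler_norm.
case: r r1 => [r| |]// r1; rewrite [three_over _]/=; last first.
  rewrite mul0r subr0 powRr0 mul1r powRr1//.
  apply: (@le_trans _ _ (\int[torus]_x ('N[torus]_+oo[EFin \o f] * `|g x|%:E))%E).
    apply: ae_ge0_le_integral => //.
    - by apply/measurable_EFinP; apply: measurableT_comp => //; exact: measurable_funM.
    - by move=> x _; rewrite mule_ge0// Lnorm_ge0.
    - apply: emeasurable_funM => //.
      by apply/measurable_EFinP; apply: measurableT_comp.
    - have muT : (0 < torus [set: mE])%E by rewrite torusT lte_fin exprn_gt0// mulr_gt0// pi_gt0.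
      rewrite unlock /Lnorm muT.
      have := ess_sup_ge torus (abse \o (EFin \o f)).
      apply: filterS => x /= fx _.
      by rewrite normrM EFinM lee_wpmul2r.
  rewrite ge0_integralZl//.
  - by rewrite lee_wpmul2l// Lnorm_ge0.
  - by apply/measurable_EFinP; apply: measurableT_comp.
  - exact: Lnorm_ge0.
rewrite lte_fin in r1; have r0 : 0 < r by rewrite (lt_trans _ r1).
pose q := r / (r - 1).
have r10 : 0 < r - 1 by rewrite subr_gt0.
have q0 : 0 < q by rewrite divr_gt0.
have qV : q^-1 = 1 - r^-1 by rewrite /q invf_div mulrBl divff ?mul1r// gt_eqF.
have := @hoelder _ _ _ torus f g r q mf mg r0 q0 _; rewrite qV addrC subrK => /(_ erefl).
rewrite Lnorm1 => /le_trans; apply.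
rewrite lee_wpmul2l ?Lnorm_ge0//.
have q1 : (0 < 1 :> R) && (1 <= q) by rewrite ltr01 /q ler_pdivlMr//; lra.
apply: le_trans (Lnorm_interpolation q1 mg gA (B := B) _) _.
  by under eq_integral do rewrite powRr1//.
by rewrite mul1r qV subKr [3 / r / 3]mulrAC divff ?mul1r ?pnatr_eq0.
Qed.

End lp_bounds.

(** * Pairing of blocks with waves *)

Section pairing.
Context {R : realType}.
Local Notation E := (R * R * R)%type.
Local Notation mR := (measurableTypeR R).
Local Notation mE := (mR * mR * mR)%type.
Local Notation K := (int * int * int)%type.
Implicit Types (k l : K) (c d : R) (x v : E) (q : int).

Lemma integrable_Rintegral (f : mE -> R) : torus.-integrable setT (EFin \o f) ->
  (\int[torus]_x (f x)%:E = (\int[torus]_x f x)%:E)%E.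
Proof. by move=> fi; rewrite /Rintegral fineK//; exact: integrable_fin_num. Qed.

Lemma integral_sqr_waves (I : finType) (a : I -> R) (m : I -> K) c :
  injective m -> (forall i j, m i + m j != 0) ->
  (\int[torus]_x ((\sum_i a i * wave (m i) c x) ^+ 2)%:E =
   ((2 * pi) ^+ 3 / 2 * \sum_i a i ^+ 2)%:E)%E.
Proof.
move=> minj mopp.
have iw i j : torus.-integrable setT (EFin \o ((fun x =>
    (a i * a j) * (wave (m i) c x * wave (m j) c x)) : mE -> R)).
  exact/integrable_torusZ/integrable_wave_wave.
under eq_integral.
  move=> x _; rewrite expr2 mulr_suml.
  under eq_bigr do (rewrite mulr_sumr; under eq_bigr do rewrite mulrACA).
  over.
rewrite integrable_Rintegral; last first.
  by apply: integrable_torus_sum => i; exact: integrable_torus_sum.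
congr EFin; rewrite Rintegral_sum => [|i]; last exact: integrable_torus_sum.
rewrite mulr_sumr; apply: eq_bigr => i _; rewrite Rintegral_sum//.
rewrite (bigD1 i)//= big1 ?addr0.
  rewrite RintegralZl//; last exact: integrable_wave_wave.
  by rewrite integral_waveM (negbTE (mopp i i)) eqxx subrr cos0 mul0r add0r mul1r mulr1 -expr2 mulrC.
move=> j ji; rewrite RintegralZl//; last exact: integrable_wave_wave.
by rewrite integral_waveM (negbTE (mopp i j)) (inj_eq minj) eq_sym (negbTE ji) !mul0r addr0 !mulr0.
Qed.

Variable chi : E -> R.
Hypothesis hchi : besov_cutoff chi.

Lemma coefN (f : E -> R) k : coef f (- k) 0 = coef f k 0.
Proof. by apply: eq_Rintegral => x _; rewrite waveN. Qed.

(** The multiplier is 1 at [l] and, by evenness, at [- l]; each of these two frequencies yields half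
    of the coefficient. *)
Lemma integral_Re_block_wave q (f : E -> R) l : phi_ chi q (freq l) = 1 ->
  \int[torus]_x (complex.Re (block chi q f x) * wave l 0 x) = coef f l 0.
Proof.
move=> phil; have [s us hs] := phi_support hchi q.
have philN : phi_ chi q (freq (- l)) = 1 by rewrite (phi_even hchi).
have ls : l \in s by apply: hs; rewrite phil oner_neq0.
have lNs : - l \in s by apply: hs; rewrite philN oner_neq0.
have pi3 : (2 * pi) ^+ 3 != 0 :> R by rewrite expf_neq0// mulf_neq0// gt_eqF// pi_gt0.
pose w (k : K) x := phi_ chi q (freq k) / (2 * pi) ^+ 3 *
  (coef f k 0 * (wave k 0 x * wave l 0 x) +
   coef f k (- (pi / 2)) * (wave k (- (pi / 2)) x * wave l 0 x)).
have iw k c : torus.-integrable setT (EFin \o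
    ((fun x => coef f k c * (wave k c x * wave l 0 x)) : mE -> R)).
  exact/integrable_torusZ/integrable_wave_wave.
transitivity (\int[torus]_x \sum_(k <- s) w k x).
  apply: eq_Rintegral => x _; rewrite (block_sumE us hs)/= mulr_suml.
  by apply: eq_bigr => k _; rewrite /w; ring.
rewrite Rintegral_sum => [|k]; last first.
  by apply: integrable_torusZ; exact: integrable_torusD.
rewrite (eq_bigr (fun k => 2^-1 * (phi_ chi q (freq k) * coef f k 0 * (k == l)%:R +
    phi_ chi q (freq k) * coef f k 0 * (k == - l)%:R))); last first.
  move=> k _; rewrite RintegralZl//; last exact: integrable_torusD.
  rewrite RintegralD//; try exact: iw.
  rewrite !RintegralZl//; try exact: integrable_wave_wave.
  rewrite !integral_waveM !addr0 !subr0 cosN cos_pihalf cos0 !mulr0 addr0 !mulr0 addr0.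
  rewrite addr_eq0; move: ((2 * pi) ^+ 3) pi3 => P P0; field.
  by [].
rewrite -mulr_sumr big_split/= !sum_delta//.
- by rewrite phil philN coefN; field.
- by rewrite lNs.
- by rewrite ls.
Qed.

Lemma normr_Re_le (z : R[i]) : `|complex.Re z| <= Normc.normc z.
Proof.
case: z => a b /=; rewrite -sqrtr_sqr ler_sqrt ?lerDl ?sqr_ge0//.
by rewrite addr_ge0// sqr_ge0.
Qed.

Lemma Re_block_le_norm q (v : field R) (i : 'I_3) x :
  `|complex.Re (block chi q (v i) x)| <= block_norm chi q v x.
Proof.
apply: (le_trans (normr_Re_le _)).
have nc0 (z : R[i]) : 0 <= Normc.normc z by case: z => a b /=; exact: sqrtr_ge0.
rewrite /block_norm -[leLHS]ger0_norm// -sqrtr_sqr ler_sqrt; last first.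
  by apply: sumr_ge0 => j _; exact: sqr_ge0.
by rewrite (bigD1 i)//= lerDl sumr_ge0// => j _; exact: sqr_ge0.
Qed.

Lemma measurable_sqrt : measurable_fun setT (Num.sqrt : mR -> mR).
Proof. by apply: continuous_measurable_fun; exact: sqrt_continuous. Qed.

Lemma measurable_Re_block q (f : E -> R) :
  measurable_fun [set: mE] ((fun x => complex.Re (block chi q f x)) : mE -> mR).
Proof.
have [s us hs] := phi_support hchi q.
under eq_fun do rewrite (block_sumE us hs) /=.
apply: measurable_sum => k; apply: measurable_funM => //.
by apply: measurable_funD; apply: measurable_funM => //; exact: measurable_wave.
Qed.

Lemma Re_block_bounded q (f : E -> R) :
  exists M, forall x, `|complex.Re (block chi q f x)| <= M.
Proof.
have [s us hs] := phi_support hchi q.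
exists (\sum_(k <- s) `|phi_ chi q (freq k) * (2 * pi) ^- 3| *
  (`|coef f k 0| + `|coef f k (- (pi / 2))|)) => x.
rewrite (block_sumE us hs)/=; apply: le_trans (ler_norm_sum _ _ _) _.
apply: ler_sum => k _; rewrite normrM ler_wpM2l//.
by apply: le_trans (ler_normD _ _) _; rewrite lerD// normrM ler_piMr// wave_le1.
Qed.

Lemma integrable_Re_block_bounded q (f : E -> R) (g : mE -> R) (M : R) :
  measurable_fun setT g -> (forall x, `|g x| <= M) ->
  torus.-integrable setT (EFin \o ((fun x => complex.Re (block chi q f x) * g x) : mE -> R)).
Proof.
move=> mg gM; have [C hC] := Re_block_bounded q f.
apply: (@integrable_torus_bounded _ _ (C * M)) => [|x _].
  by apply: measurable_funM => //; exact: measurable_Re_block.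
by rewrite normrM ler_pM.
Qed.

Lemma measurable_Im_block q (f : E -> R) :
  measurable_fun [set: mE] ((fun x => complex.Im (block chi q f x)) : mE -> mR).
Proof.
have [s us hs] := phi_support hchi q.
under eq_fun do rewrite (block_sumE us hs) /=.
apply: measurable_sum => k; apply: measurable_funM => //.
by apply: measurable_funB; apply: measurable_funM => //; exact: measurable_wave.
Qed.

Lemma measurable_block_norm q (v : field R) :
  measurable_fun [set: mE] (block_norm chi q v : mE -> mR).
Proof.
apply: measurableT_comp; first exact: measurable_sqrt.
apply: measurable_sum => i; apply: measurable_funX.
have -> : (fun x => Normc.normc (block chi q (v i) x)) =
    (fun x => Num.sqrt (complex.Re (block chi q (v i) x) ^+ 2 +
                        complex.Im (block chi q (v i) x) ^+ 2)).
  by apply/funext => x; case: (block _ _ _ _).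
apply: measurableT_comp; first exact: measurable_sqrt.
apply: measurable_funD; apply: measurable_funX.
  exact: measurable_Re_block.
exact: measurable_Im_block.
Qed.

End pairing.

(** * Wave packets *)

Section packets.
Context {R : realType}.
Local Notation E := (R * R * R)%type.
Local Notation mR := (measurableTypeR R).
Local Notation mE := (mR * mR * mR)%type.
Local Notation K := (int * int * int)%type.
Local Notation T N := ('I_N * 'I_N * 'I_N)%type.
Implicit Types (k l : K) (x : E) (n N : nat).

Lemma sum3 (F : 'I_3 -> R) : \sum_i F i = F 0 + F 1 + F 2.
Proof.
rewrite !big_ord_recl big_ord0 addr0 addrA.
by congr (_ + F _ + F _); apply/val_inj.
Qed.

Lemma normr_MDM_le (p p' q q' : R) :
  `|p * q + p' * q'| <= 2^-1 * (p ^+ 2 + q ^+ 2 + (p' ^+ 2 + q' ^+ 2)).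
Proof.
have h1 := sqr_ge0 (p - q); have h2 := sqr_ge0 (p + q).
have h3 := sqr_ge0 (p' - q'); have h4 := sqr_ge0 (p' + q').
by rewrite ler_norml; apply/andP; split; nra.
Qed.

Lemma sqr_sum_le (I : finType) (F : I -> R) :
  (\sum_i F i) ^+ 2 <= #|I|%:R * \sum_i F i ^+ 2.
Proof.
rewrite expr2 big_distrlr/=.
have h i j : F i * F j <= 2^-1 * (F i ^+ 2 + F j ^+ 2).
  by have := sqr_ge0 (F i - F j); rewrite !expr2; nra.
apply: (@le_trans _ _ (\sum_i \sum_j 2^-1 * (F i ^+ 2 + F j ^+ 2))).
  by apply: ler_sum => i _; exact: ler_sum.
have -> : \sum_i \sum_j 2^-1 * (F i ^+ 2 + F j ^+ 2) = #|I|%:R * \sum_i F i ^+ 2.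
  under eq_bigr do rewrite -mulr_sumr big_split/= sumr_const -[X in X + _]mulr_natl.
  rewrite -mulr_sumr big_split/= -mulr_sumr sumr_const -[X in _ + X]mulr_natl.
  by set s := \sum_i _; field.
exact: lexx.
Qed.

Definition emb N (b : T N) : K := (Posz b.1.1, Posz b.1.2, Posz b.2).

(** The frequencies used around this point have first coordinate between [19 * 2^n] and [22 * 2^n]
    and the other two at most [2 * 2^n] in absolute value. Since [22^2 + 2^2 + 2^2 < 24^2], they
    stay in the annulus from [16 * 2^n] to [24 * 2^n], on which the block of level [n + 4] acts as
    the identity. *)
Definition center n : K := (Posz (20 * 2 ^ n), 0, 0).

Definition level n : int := Posz (n + 4).

Lemma emb_inj N : injective (@emb N).
Proof.
by move=> [[a b] c] [[a' b'] c'] [] /ord_inj -> /ord_inj -> /ord_inj ->.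
Qed.

Lemma cardT N : #|{: T N}| = (N ^ 3)%N.
Proof. by rewrite !card_prod card_ord !expnS expn0 muln1 mulnA. Qed.

Lemma lambda_level n : lambda (level n) = 16 * 2 ^+ n :> R.
Proof. by rewrite /lambda /level -exprnP exprD mulrC; congr (_ * _); ring. Qed.

Lemma euclid_level n k :
  (Posz (19 * 2 ^ n) <= k.1.1 <= Posz (22 * 2 ^ n))%R ->
  (- Posz (2 * 2 ^ n) <= k.1.2 <= Posz (2 * 2 ^ n))%R ->
  (- Posz (2 * 2 ^ n) <= k.2 <= Posz (2 * 2 ^ n))%R ->
  lambda (level n) <= euclid (freq k : E) <= 3 / 2 * lambda (level n).
Proof.
case: k => [[k1 k2] k3] /=; rewrite lambda_level => h1 h2 h3.
pose L : R := 2 ^+ n; have L0 : 0 < L by rewrite exprn_gt0.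
have LE (m : nat) : (Posz (m * 2 ^ n))%:~R = m%:R * L :> R.
  by rewrite -[LHS]/((m * 2 ^ n)%:R) natrM natrX.
have toR (a b c : int) : (a <= b <= c)%R ->
    ((a%:~R : R) <= b%:~R) && ((b%:~R : R) <= c%:~R).
  by rewrite !ler_int.
move/toR : h1; move/toR : h2; move/toR : h3; rewrite !mulrNz !LE -/L.
move=> /andP[h1 h2] /andP[h3 h4] /andP[h5 h6].
rewrite /euclid /dot/=; set s := _ + _ + _.
have s0 : 0 <= s by rewrite /s -!expr2 !addr_ge0// sqr_ge0.
apply/andP; split.
  rewrite -[leLHS]ger0_norm; last by rewrite mulr_ge0// ltW.
  rewrite -sqrtr_sqr ler_sqrt// /s; nra.
rewrite -[leRHS]ger0_norm; last by rewrite !mulr_ge0// ltW.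
rewrite -sqrtr_sqr ler_sqrt; last exact: sqr_ge0.
rewrite /s; nra.
Qed.

Definition mode n N (c : T N) : K := center n + emb c.

(* [k . polar k = 0], so that packets are divergence free. *)
Definition polar k (i : 'I_3) : R :=
  if i == 0 then - (kcomp k 1 / kcomp k 0) else if i == 1 then 1 else 0.

Definition packet n N (i : 'I_3) x : R :=
  \sum_(c : T N) polar (mode n c) i * wave (mode n c) 0 x.

Definition pmode n N (a : T (2 * N)) (b : T N) : K := center n + emb a - emb b.

(* All modes of the packet have coefficient 1 in each inner sum, and averaging
   over [b] keeps the L^1 norm bounded, as for a de la Vallee Poussin kernel. *)
Definition probe n N x : R :=
  (N%:R ^+ 3)^-1 * \sum_(b : T N) \sum_(a : T (2 * N)) wave (pmode n a b) 0 x.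

(* Its derivative in the first direction is [probe]. *)
Definition antiprobe n N x : R :=
  (N%:R ^+ 3)^-1 * \sum_(b : T N) \sum_(a : T (2 * N))
     (kcomp (pmode n a b) 0)^-1 * wave (pmode n a b) (- (pi / 2)) x.

Section fixed.
Variables (n N : nat).
Hypotheses (N0 : (0 < N)%N) (Nn : (N <= 2 ^ n)%N).

Let NR0 : 0 < N%:R :> R. Proof. by rewrite ltr0n. Qed.

Lemma pmode_level a b :
  lambda (level n) <= euclid (freq (@pmode n N a b) : E) <= 3 / 2 * lambda (level n).
Proof.
case: a => [[a1 a2] a3]; case: b => [[b1 b2] b3].
have := ltn_ord a1; have := ltn_ord a2; have := ltn_ord a3.
have := ltn_ord b1; have := ltn_ord b2; have := ltn_ord b3.
move=> h1 h2 h3 h4 h5 h6.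
by apply: euclid_level; rewrite /pmode /center /emb /=; lia.
Qed.

Lemma mode_level (c : T N) :
  lambda (level n) <= euclid (freq (mode n c) : E) <= 3 / 2 * lambda (level n).
Proof.
case: c => [[c1 c2] c3].
have := ltn_ord c1; have := ltn_ord c2; have := ltn_ord c3 => h1 h2 h3.
by apply: euclid_level; rewrite /mode /center /emb /=; lia.
Qed.

Lemma kcomp0_mode (c : T N) : 20 * 2 ^+ n <= kcomp (mode n c) 0 :> R.
Proof.
rewrite kcomp0E /mode /=.
rewrite -[X in X <= _]/(20%:R * _) -natrX -natrM -[leLHS]/((Posz _)%:~R) ler_int.
by lia.
Qed.

Lemma kcomp0_pmode a b : 16 * 2 ^+ n <= kcomp (@pmode n N a b) 0 :> R.
Proof.
rewrite kcomp0E /pmode /=; case: a => [[a1 a2] a3]; case: b => [[b1 b2] b3] /=.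
have := ltn_ord b1 => h1.
rewrite -[X in X <= _]/(16%:R * _) -natrX -natrM -[leLHS]/((Posz _)%:~R) ler_int.
by lia.
Qed.

Lemma kcomp1_mode (c : T N) : `|kcomp (mode n c) 1| <= 2 ^+ n :> R.
Proof.
rewrite kcomp1E /mode /= add0r; case: c => [[c1 c2] c3] /=.
rewrite ger0_norm ?ler0z// -natrX -[leRHS]/((Posz _)%:~R) ler_int.
by have := ltn_ord c2; lia.
Qed.

Lemma polar_le1 (c : T N) i : `|polar (mode n c) i| <= 1.
Proof.
have L0 : 0 < 2 ^+ n :> R by rewrite exprn_gt0.
rewrite /polar; case: ifP => _; last by case: ifP; rewrite ?normr1 ?normr0.
have c0 := kcomp0_mode c; rewrite normrN normrM normfV.
rewrite ler_pdivrMr ?mul1r; last by rewrite normr_gt0 gt_eqF//; lra.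
apply: (le_trans (kcomp1_mode c)); rewrite (le_trans _ (ler_norm _))//; lra.
Qed.

Lemma mode_inj : injective (@mode n N).
Proof. by move=> c d /addrI /emb_inj. Qed.

Lemma mode_opp (c d : T N) : mode n c + mode n d != 0.
Proof.
apply/eqP => /(congr1 (fun k : K => k.1.1)) /=.
have : (0 < 2 ^ n)%N by rewrite expn_gt0.
by lia.
Qed.

Lemma sumT_le (F : T N -> R) (C : R) : (forall c, F c <= C) ->
  \sum_c F c <= N%:R ^+ 3 * C.
Proof.
move=> FC; apply: (@le_trans _ _ (\sum_(c : T N) C)); first exact: ler_sum.
by rewrite sumr_const -natrX mulr_natl cardT.
Qed.

Lemma packet_le i x : `|packet n N i x| <= N%:R ^+ 3.
Proof.
apply: (le_trans (ler_norm_sum _ _ _)).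
rewrite -[leRHS]mulr1; apply: sumT_le => c.
by rewrite normrM mulr_ile1// ?polar_le1// wave_le1.
Qed.

Lemma packet_sqr i : (\int[torus]_x (packet n N i x ^+ 2)%:E <=
  ((2 * pi) ^+ 3 * N%:R ^+ 3)%:E)%E.
Proof.
rewrite integral_sqr_waves; [|exact: mode_inj|exact: mode_opp].
have pi3 : 0 < (2 * pi) ^+ 3 :> R by rewrite exprn_gt0// mulr_gt0// pi_gt0.
have h : \sum_(c : T N) polar (mode n c) i ^+ 2 <= N%:R ^+ 3 * 1.
  by apply: sumT_le => c; rewrite -real_normK ?num_real// expr_le1// polar_le1.
rewrite lee_fin -mulrA ler_pM2l//.
by have := exprn_gt0 3 NR0; lra.
Qed.

Lemma measurable_packet i : measurable_fun [set: mE] (packet n N i : mE -> mR).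
Proof.
by apply: measurable_sum => c; apply: measurable_funM => //; exact: measurable_wave.
Qed.

Lemma periodic_packet i : periodic (packet n N i).
Proof. by move=> j x; apply: eq_bigr => c _; rewrite periodic_wave. Qed.

Lemma packet_div_free : div_free (packet n N).
Proof.
move=> psi ppsi spsi; have [cpsi dpsi] := spsi [::].
have cDpsi i : continuous ('D_(basis i) psi) by have [] := spsi [:: basis i].
have [M DM] : exists M, forall i x, cell x -> `|'D_(basis i) psi x| <= M.
  have /choice[M MP] i := continuous_cell_bounded (cDpsi i).
  by exists (\sum_i `|M i|) => i x /(MP i) /le_trans; apply;
    rewrite (bigD1 i)//= (le_trans (ler_norm _))// lerDl sumr_ge0.
have iw i k : torus.-integrable setT (EFin \o ((fun x =>
    wave k 0 x * 'D_(basis i) psi x) : mE -> R)).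
  apply: (@integrable_torus_bounded _ _ M) => [|x /(DM i)].
    by apply: measurable_funM; [exact: measurable_wave|exact: continuous_measurable3].
  by rewrite normrM; apply: le_trans; rewrite ler_piMl//; exact: wave_le1.
have E1 i : \int[torus]_x (packet n N i x * 'D_(basis i) psi x) =
    \sum_(c : T N) - (polar (mode n c) i * kcomp (mode n c) i *
      \int[torus]_x (wave (mode n c) (pi / 2) x * psi x)).
  under eq_Rintegral.
    move=> x _; rewrite mulr_suml; under eq_bigr do rewrite -mulrA.
    over.
  rewrite Rintegral_sum => [|c]; last exact: integrable_torusZ.
  apply: eq_bigr => c _; rewrite RintegralZl//.
  have := wave_by_parts (mode n c) 0 ppsi cpsi (fun x => dpsi x _) (cDpsi i).
  by rewrite add0r => ->; rewrite mulrN mulrA.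
under eq_bigr do rewrite E1.
rewrite exchange_big/= big1// => c _.
have c0 : kcomp (mode n c) 0 != 0 :> R.
  have L0 : 0 < 2 ^+ n :> R by rewrite exprn_gt0.
  by have := kcomp0_mode c => ?; rewrite gt_eqF//; lra.
rewrite sum3 /polar /= !mul0r oppr0 addr0 mul1r.
set I := Rintegral _ _ _; field.
exact: c0.
Qed.

Lemma pmode_inj b : injective (@pmode n N ^~ b).
Proof. by move=> a a' /addIr /addrI /emb_inj. Qed.

Lemma pmode_opp b a a' : @pmode n N a b + pmode n a' b != 0.
Proof.
apply/eqP => /(congr1 (kcomp (R := R) ^~ 0)).
rewrite /kcomp freqD dotC dotDr freq0 dotC -/(kcomp _ 0) dotC -/(kcomp _ 0).
have L0 : 0 < 2 ^+ n :> R by rewrite exprn_gt0.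
have := kcomp0_pmode a b; have := kcomp0_pmode a' b; rewrite {1}/dot/= !mul0r !addr0.
by move=> ? ? ?; lra.
Qed.

Lemma measurable_probe : measurable_fun [set: mE] (probe n N : mE -> mR).
Proof.
apply: measurable_funM => //; apply: measurable_sum => b.
by apply: measurable_sum => a; exact: measurable_wave.
Qed.

Lemma measurable_antiprobe : measurable_fun [set: mE] (antiprobe n N : mE -> mR).
Proof.
apply: measurable_funM => //; apply: measurable_sum => b.
apply: measurable_sum => a; apply: measurable_funM => //; exact: measurable_wave.
Qed.

Lemma sumT2_le (F : T (2 * N) -> R) (C : R) : (forall c, F c <= C) ->
  \sum_c F c <= 8 * N%:R ^+ 3 * C.
Proof.
move=> FC; apply: (@le_trans _ _ (\sum_(c : T (2 * N)) C)); first exact: ler_sum.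
have -> : 8 = 2 ^+ 3 :> R by rewrite -natrX.
by rewrite sumr_const (cardT (2 * N)) -[leLHS]mulr_natl natrX natrM exprMn.
Qed.

Lemma probe_le x : `|probe n N x| <= 8 * N%:R ^+ 3.
Proof.
have N3 : 0 < N%:R ^+ 3 :> R by rewrite exprn_gt0.
rewrite normrM ger0_norm ?invr_ge0 ?(ltW N3)// mulrC ler_pdivrMr//.
apply: (le_trans (ler_norm_sum _ _ _)); rewrite mulrC; apply: sumT_le => b.
apply: (le_trans (ler_norm_sum _ _ _)); rewrite -[leRHS]mulr1; apply: sumT2_le => a.
exact: wave_le1.
Qed.

(* Writing the phases as differences of the two families below factors the
   double sum; the shift by the center keeps their frequencies away from 0. *)
Lemma probe_split x : probe n N x = (N%:R ^+ 3)^-1 *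
  ((\sum_(a : T (2 * N)) 1 * wave (center n + center n + emb a) 0 x) *
     (\sum_(b : T N) 1 * wave (mode n b) 0 x) +
   (\sum_(a : T (2 * N)) 1 * wave (center n + center n + emb a) (- (pi / 2)) x) *
     (\sum_(b : T N) 1 * wave (mode n b) (- (pi / 2)) x)).
Proof.
rewrite /probe; congr (_ * _); rewrite ![in RHS]mulr_sumr -big_split/=.
apply: eq_bigr => b _; rewrite !mulr_suml -big_split/=; apply: eq_bigr => a _.
rewrite !mul1r -!cos_wave -!sin_wave -cosB; congr cos.
rewrite -[- dot (freq (mode n b)) x]mulN1r -(dotC x) -(dotC x) -(dotC x) -dotZr -dotDr.
congr dot; rewrite scaleN1r -freqN -freqD; congr freq.
by rewrite /pmode /mode opprD addrA; congr (_ - _); rewrite [RHS]addrAC addrK.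
Qed.

(** In the form of [probe_split], AM-GM replaces the products by half the sum of the squares, and
    orthogonality evaluates these: the [N^3] from the number of frequencies cancels against the
    averaging factor, which leaves [(8 + 1) / 2], rounded up to 5, times [(2 * pi) ^+ 3]. *)
Lemma probe_L1 : (\int[torus]_x `|probe n N x|%:E <= (5 * (2 * pi) ^+ 3)%:E)%E.
Proof.
have N3 : 0 < N%:R ^+ 3 :> R by rewrite exprn_gt0.
have pi3 : 0 < (2 * pi) ^+ 3 :> R by rewrite exprn_gt0// mulr_gt0// pi_gt0.
have inj2 : injective (fun a : T (2 * N) => center n + center n + emb a).
  by move=> a a' /addrI /emb_inj.
have opp2 (a a' : T (2 * N)) :
    center n + center n + emb a + (center n + center n + emb a') != 0.
  apply/eqP => /(congr1 (fun k : K => k.1.1)) /=.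
  have : (0 < 2 ^ n)%N by rewrite expn_gt0.
  by lia.
pose P c x : R := \sum_(a : T (2 * N)) 1 * wave (center n + center n + emb a) c x.
pose Q c x : R := \sum_(b : T N) 1 * wave (mode n b) c x.
have mP c : measurable_fun [set: mE] (P c : mE -> mR).
  by apply: measurable_sum => i; apply: measurable_funM => //; exact: measurable_wave.
have mQ c : measurable_fun [set: mE] (Q c : mE -> mR).
  by apply: measurable_sum => i; apply: measurable_funM => //; exact: measurable_wave.
have iP c : (\int[torus]_x (P c x ^+ 2)%:E = ((2 * pi) ^+ 3 / 2 * (8 * N%:R ^+ 3))%:E)%E.
  rewrite integral_sqr_waves//; congr (_ * _)%:E.
  have -> : 8 = 2 ^+ 3 :> R by rewrite -natrX.
  by rewrite expr1n sumr_const (cardT (2 * N)) natrX natrM exprMn.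
have iQ c : (\int[torus]_x (Q c x ^+ 2)%:E = ((2 * pi) ^+ 3 / 2 * N%:R ^+ 3)%:E)%E.
  rewrite integral_sqr_waves//; [|exact: mode_inj|exact: mode_opp].
  by congr (_ * _)%:E; rewrite expr1n sumr_const cardT natrX.
pose S x := (P 0 x ^+ 2 + Q 0 x ^+ 2) + (P (- (pi / 2)) x ^+ 2 + Q (- (pi / 2)) x ^+ 2).
have iP2 c : torus.-integrable setT (EFin \o ((fun x => P c x ^+ 2) : mE -> R)).
  by apply: (@integrable_sqr R (P c)); [exact: mP|rewrite iP ltry].
have iQ2 c : torus.-integrable setT (EFin \o ((fun x => Q c x ^+ 2) : mE -> R)).
  by apply: (@integrable_sqr R (Q c)); [exact: mQ|rewrite iQ ltry].
have iS : torus.-integrable setT (EFin \o (S : mE -> R)).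
  by apply: integrable_torusD; exact: integrable_torusD.
apply: (@le_trans _ _ (\int[torus]_x ((N%:R ^+ 3)^-1 * (2^-1 * S x))%:E)%E).
  apply: ge0_le_integral => //.
  - apply/measurable_EFinP; apply: measurableT_comp => //; exact: measurable_probe.
  - apply/measurable_EFinP; apply: measurable_funM => //; apply: measurable_funM => //.
    by case/integrableP : iS => /measurable_EFinP.
  - move=> x _; rewrite lee_fin probe_split normrM ger0_norm ?invr_ge0 ?(ltW N3)//.
    rewrite ler_pM2l ?invr_gt0// -/(P 0 x) -/(P (- (pi / 2)) x) -/(Q 0 x) -/(Q (- (pi / 2)) x).
    exact: normr_MDM_le.
rewrite integrable_Rintegral; last exact/integrable_torusZ/integrable_torusZ.
rewrite RintegralZl//; last exact/integrable_torusZ.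
rewrite RintegralZl// /S !RintegralD//; try exact: integrable_torusD.
have rP c : \int[torus]_x P c x ^+ 2 = (2 * pi) ^+ 3 / 2 * (8 * N%:R ^+ 3).
  by rewrite /Rintegral iP.
have rQ c : \int[torus]_x Q c x ^+ 2 = (2 * pi) ^+ 3 / 2 * N%:R ^+ 3.
  by rewrite /Rintegral iQ.
rewrite !rP !rQ lee_fin mulrC ler_pdivrMr//; nra.
Qed.

Lemma sqr_mean_le (F : T N -> R) :
  ((N%:R ^+ 3)^-1 * \sum_b F b) ^+ 2 <= (N%:R ^+ 3)^-1 * \sum_b F b ^+ 2.
Proof.
have N3 : 0 < N%:R ^+ 3 :> R by rewrite exprn_gt0.
rewrite exprMn expr2 -mulrA ler_pM2l ?invr_gt0// mulrC ler_pdivrMr// mulrC.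
by have := sqr_sum_le F; rewrite (cardT N) natrX.
Qed.

(** For different [b] the frequencies [pmode n a b] overlap, so orthogonality is used for each fixed
    [b], and the mean over [b] is handled by convexity. The coefficients are at most
    [1 / (16 * 2^n)], which leaves a factor 64 to spare. *)
Lemma antiprobe_sqr : (\int[torus]_x (antiprobe n N x ^+ 2)%:E <=
  ((2 * pi) ^+ 3 * N%:R ^+ 3 / 4 ^+ n)%:E)%E.
Proof.
have N3 : 0 < N%:R ^+ 3 :> R by rewrite exprn_gt0.
have L0 : 0 < 2 ^+ n :> R by rewrite exprn_gt0.
have pi3 : 0 < (2 * pi) ^+ 3 :> R by rewrite exprn_gt0// mulr_gt0// pi_gt0.
pose z b x : R := \sum_(a : T (2 * N)) (kcomp (pmode n a b) 0)^-1 *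
  wave (pmode n a b) (- (pi / 2)) x.
have mz b : measurable_fun [set: mE] (z b : mE -> mR).
  by apply: measurable_sum => i; apply: measurable_funM => //; exact: measurable_wave.
have z2 b : (\int[torus]_x (z b x ^+ 2)%:E <=
    ((2 * pi) ^+ 3 / 2 * (8 * N%:R ^+ 3 * (16^-1 ^+ 2 / 4 ^+ n)))%:E)%E.
  rewrite integral_sqr_waves; [|exact: pmode_inj|exact: pmode_opp].
  rewrite lee_fin ler_pM2l ?divr_gt0//; apply: sumT2_le => a.
  have c0 := kcomp0_pmode a b.
  have -> : (4 : R) ^+ n = (2 ^+ n) ^+ 2 by rewrite -exprM mulnC exprM; congr (_ ^+ _); ring.
  have L16 : 0 < 16 * 2 ^+ n :> R by rewrite mulr_gt0.
  rewrite (_ : 16^-1 ^+ 2 / (2 ^+ n) ^+ 2 = ((16 * 2 ^+ n)^-1) ^+ 2); last first.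
    by move: (2 ^+ n) L0 => y y0; field; rewrite gt_eqF.
  have cp : 0 < kcomp (pmode n a b) 0 :> R by exact: lt_le_trans c0.
  rewrite lerXn2r ?nnegrE ?invr_ge0//; try exact: ltW.
  by rewrite lef_pV2// posrE.
have iz b : torus.-integrable setT (EFin \o ((fun x => z b x ^+ 2) : mE -> R)).
  apply: (@integrable_sqr R (z b)); first exact: mz.
  by apply: le_lt_trans (z2 b) _; rewrite ltry.
apply: (@le_trans _ _ (\int[torus]_x ((N%:R ^+ 3)^-1 * \sum_b z b x ^+ 2)%:E)%E).
  apply: ge0_le_integral => //.
  - by move=> x _; rewrite lee_fin sqr_ge0.
  - by apply/measurable_EFinP; apply: measurable_funX; exact: measurable_antiprobe.
  - apply/measurable_EFinP; apply: measurable_funM => //; apply: measurable_sum => b.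
    by apply: measurable_funX; exact: mz.
  - by move=> x _; rewrite lee_fin; exact: sqr_mean_le.
rewrite integrable_Rintegral; last by apply/integrable_torusZ/integrable_torus_sum.
rewrite RintegralZl//; last exact/integrable_torus_sum.
rewrite Rintegral_sum// lee_fin mulrC ler_pdivrMr//.
have rz b : \int[torus]_x z b x ^+ 2 <=
    (2 * pi) ^+ 3 / 2 * (8 * N%:R ^+ 3 * (16^-1 ^+ 2 / 4 ^+ n)).
  by rewrite -lee_fin -integrable_Rintegral.
apply: (le_trans (sumT_le rz)).
have P40 : 0 < (4 ^+ n)^-1 :> R by rewrite invr_gt0 exprn_gt0.
move: ((2 * pi) ^+ 3) pi3 (N%:R ^+ 3) N3 ((4 ^+ n)^-1) P40 => p p0 m m0 l l0.
have : 0 < p * m * m * l by rewrite !mulr_gt0.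
rewrite (_ : m * (p / 2 * (8 * m * (16^-1 ^+ 2 * l))) = (64^-1) * (p * m * m * l)).
  by rewrite (_ : p * m * l * m = p * m * m * l); [move: (p * m * m * l) => y y0; lra|ring].
by field.
Qed.

End fixed.
End packets.

(** * Pairing of packets and of weakly differentiable functions with the probe *)

Section packet_pairing.
Context {R : realType}.
Local Notation E := (R * R * R)%type.
Local Notation mR := (measurableTypeR R).
Local Notation mE := (mR * mR * mR)%type.
Local Notation K := (int * int * int)%type.
Local Notation T N := ('I_N * 'I_N * 'I_N)%type.
Implicit Types (k l : K) (x : E).

Variables (n N : nat).
Hypotheses (N0 : (0 < N)%N) (Nn : (N <= 2 ^ n)%N).

(** The reason why [a] runs over a cube of side [2 * N] in [probe]: for each shift [b], every mode
    [c] of the packet occurs as some [pmode n a b]. *)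
Lemma emb_add (c b : T N) : exists a : T (2 * N), emb a = emb c + emb b.
Proof.
have h (i j : 'I_N) : (i + j < 2 * N)%N.
  by have := ltn_ord i; have := ltn_ord j; lia.
case: c b => [[c1 c2] c3] [[b1 b2] b3].
by exists (Ordinal (h c1 b1), Ordinal (h c2 b2), Ordinal (h c3 b3)).
Qed.

Lemma integral_mul_probe (f : mE -> R) :
  (forall k, torus.-integrable setT (EFin \o (fun x => f x * wave k 0 x))) ->
  \int[torus]_x (f x * probe n N x) = (N%:R ^+ 3)^-1 *
    \sum_(b : T N) \sum_(a : T (2 * N)) coef f (pmode n a b) 0.
Proof.
move=> fi; under eq_Rintegral.
  move=> x _; rewrite /probe mulrCA mulr_sumr.
  under eq_bigr do rewrite mulr_sumr.
  over.
rewrite RintegralZl//; last by apply: integrable_torus_sum => b; exact: integrable_torus_sum.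
rewrite Rintegral_sum => [|b]; last exact: integrable_torus_sum.
congr (_ * _); apply: eq_bigr => b _; rewrite Rintegral_sum//.
Qed.

(** For each of the [N^3] shifts [b], each of the [N^3] modes resonates with exactly one [a]; the
    averaging factor leaves [N^3]. Component 1 is the one on which [polar] equals 1 for all
    modes. *)
Lemma integral_packet_probe : \int[torus]_x (packet n N 1 x * probe n N x : R) =
  (2 * pi) ^+ 3 / 2 * N%:R ^+ 3.
Proof.
have N3 : 0 < N%:R ^+ 3 :> R by rewrite exprn_gt0// ltr0n.
rewrite integral_mul_probe => [|k]; last first.
  apply: (@integrable_L2_bounded _ _ _ 1).
  - exact: measurable_packet.
  - by apply: le_lt_trans (packet_sqr _ _ _) _ => //; rewrite ltry.
  - exact: measurable_wave.
  - by move=> x _; exact: wave_le1.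
have c1 (b : T N) (a : T (2 * N)) : coef (packet n N 1 : E -> R) (pmode n a b) 0 =
    (2 * pi) ^+ 3 / 2 * \sum_(c : T N) (emb a == emb c + emb b)%:R.
  rewrite coef_waves0; congr (_ * _); apply: eq_bigr => c _.
  rewrite {1}/polar /= mul1r.
  have -> : (pmode n a b == - mode n c) = false.
    apply/negP => /eqP /(congr1 (fun k : K => k.1.1)) /=.
    have := ltn_ord b.1.1; have : (0 < 2 ^ n)%N by rewrite expn_gt0.
    by lia.
  by rewrite addr0 /pmode /mode -addrA (inj_eq (addrI _)) subr_eq.
under eq_bigr do (under eq_bigr do rewrite c1; rewrite -mulr_sumr).
rewrite -mulr_sumr.
have s1 (b c : T N) : \sum_(a : T (2 * N)) (emb a == emb c + emb b)%:R = 1 :> R.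
  have [a0 ea0] := emb_add c b.
  rewrite (bigD1 a0)//= ea0 eqxx big1 ?addr0// => a aa0.
  by rewrite -ea0 (inj_eq (@emb_inj _)) (negbTE aa0).
under eq_bigr do (rewrite exchange_big/=; under eq_bigr do rewrite s1).
rewrite !sumr_const cardT -(mulr_natl _ (N ^ 3)) natrX.
by move: (N%:R ^+ 3) N3 => m m0; field; rewrite gt_eqF.
Qed.

Lemma integral_weak_deriv_probe (w h : E -> R) : L2_fun w -> weak_deriv 0 w h ->
  \int[torus]_x (w x * probe n N x) = - \int[torus]_x (h x * antiprobe n N x).
Proof.
move=> [_ mw w2] [[_ mh h2] wh].
rewrite integral_mul_probe => [|k]; last exact: integrable_waveM.
under [in RHS]eq_Rintegral.
  move=> x _; rewrite /antiprobe mulrCA mulr_sumr.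
  under eq_bigr do (rewrite mulr_sumr; under eq_bigr do rewrite mulrCA).
  over.
have ih k c : torus.-integrable setT (EFin \o ((fun x => h x * wave k c x) : mE -> R)).
  exact: integrable_waveM.
rewrite RintegralZl//; last first.
  by apply: integrable_torus_sum => b; apply: integrable_torus_sum => a; exact: integrable_torusZ.
rewrite Rintegral_sum => [|b]; last first.
  by apply: integrable_torus_sum => a; exact: integrable_torusZ.
rewrite -mulrN -sumrN; congr (_ * _); apply: eq_bigr => b _.
rewrite Rintegral_sum => [|a]; last exact: integrable_torusZ.
rewrite -sumrN; apply: eq_bigr => a _; rewrite RintegralZl//.
have l0 : kcomp (pmode n a b) 0 != 0 :> R.
  have c0 := @kcomp0_pmode R _ _ N0 Nn a b.
  by rewrite gt_eqF//; apply: lt_le_trans c0; rewrite mulr_gt0// exprn_gt0.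
(* With this phase the derivative in direction 0 is [kcomp] times the wave of phase 0 that occurs in
   [probe]. *)
have := wh (wave (pmode n a b) (- (pi / 2))) (periodic_wave _ _) (smooth_wave _ _).
set l := pmode n a b in l0 *.
under eq_Rintegral do rewrite derive_wave addNr mulrCA.
rewrite RintegralZl//; last exact: integrable_waveM.
rewrite -/(kcomp l 0) -/(coef w l 0) => e.
by apply: (mulfI l0); rewrite e mulrN mulrA divff// mul1r.
Qed.

(* AM-GM with the weight that balances the two squared L^2 norms. *)
Lemma weak_deriv_probe_le (w h : E -> R) : L2_fun w -> weak_deriv 0 w h ->
  `|\int[torus]_x (w x * probe n N x)| <=
  (\int[torus]_x (h x ^+ 2) + (2 * pi) ^+ 3) * (N%:R `^ (3 / 2) / 2 ^+ n).
Proof.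
move=> w2 wh; have [[_ mh h2] _] := wh.
rewrite (integral_weak_deriv_probe w2 wh) normrN.
have NR0 : 0 < N%:R :> R by rewrite ltr0n.
have L0 : 0 < 2 ^+ n :> R by rewrite exprn_gt0.
set e := N%:R `^ (3 / 2) / 2 ^+ n; have e0 : 0 < e by rewrite divr_gt0// powR_gt0.
have ee : e ^+ 2 = N%:R ^+ 3 / 4 ^+ n.
  rewrite /e expr_div_n -powR_mulrn ?powR_ge0// -powRrM.
  rewrite (_ : 3 / 2 * 2 = 3%:R) ?powR_mulrn ?ltW//; last by field.
  by congr (_ / _); rewrite -exprM mulnC exprM; congr (_ ^+ _); rewrite -natrX.
have mG := @measurable_antiprobe R n N.
have G2 := @antiprobe_sqr R _ _ N0 Nn.
have ih := integrable_sqr mh h2.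
have iG : torus.-integrable setT (EFin \o ((fun x => antiprobe n N x ^+ 2) : mE -> R)).
  by apply: (@integrable_sqr R (antiprobe n N)) => //; exact: le_lt_trans G2 (ltry _).
have iS : torus.-integrable setT (EFin \o ((fun x => e * h x ^+ 2 + e^-1 * antiprobe n N x ^+ 2) : mE -> R)).
  by apply: integrable_torusD; exact: integrable_torusZ.
have ihG : torus.-integrable setT (EFin \o ((fun x => h x * antiprobe n N x) : mE -> R)).
  by apply: (@integrable_L2M R h (antiprobe n N)) => //; exact: le_lt_trans G2 (ltry _).
apply: (le_trans (le_normr_Rintegral measurableT ihG)).
apply: (@le_trans _ _ (\int[torus]_x (e * h x ^+ 2 + e^-1 * antiprobe n N x ^+ 2))).
  apply: le_Rintegral => //.
    have := integrable_abse ihG.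
    by apply: eq_integrable.
  move=> x _; move: (h x) (antiprobe n N x) => y z.
  have := mulfV (lt0r_neq0 e0); have : 0 < e^-1 by rewrite invr_gt0.
  move: e e0 {ee iS} => e e0; move: (e^-1) => f f0 ef.
  have h1 := sqr_ge0 (e * y - z); have h2' := sqr_ge0 (e * y + z).
  have -> : e * y ^+ 2 + f * z ^+ 2 = f * ((e * y) ^+ 2 + z ^+ 2).
    by rewrite -[in LHS](mul1r (e * y ^+ 2)) -ef; ring.
  have -> : y * z = f * ((e * y) * z) by rewrite -[LHS]mul1r -ef; ring.
  rewrite normrM gtr0_norm// ler_pM2l//; exact: normM_le_sqrD.
rewrite RintegralD//; [|exact: integrable_torusZ|exact: integrable_torusZ].
rewrite !RintegralZl// mulrDl mulrC lerD2l.
rewrite mulrC ler_pdivrMr// -mulrA -expr2 ee mulrA -lee_fin -integrable_Rintegral//.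
Qed.

Variable chi : E -> R.
Hypothesis hchi : besov_cutoff chi.

(** All frequencies of [probe] lie in the annulus where the multiplier of this level is 1. *)
Lemma Re_block_probe (f : E -> R) : L2_fun f ->
  \int[torus]_x (complex.Re (block chi (level n) f x) * probe n N x) =
  \int[torus]_x (f x * probe n N x).
Proof.
move=> [_ mf f2]; rewrite !integral_mul_probe; first last.
- by move=> k; apply: integrable_Re_block_bounded => //;
    [exact: measurable_wave|exact: wave_le1].
- by move=> k; exact: integrable_waveM.
congr (_ * _); apply: eq_bigr => b _; apply: eq_bigr => a _.
apply: integral_Re_block_wave => //.
by apply: phi_self => //; exact: pmode_level.
Qed.

(** Duality read as a lower bound for the block norm, by a pairing that can be computed; the two
    factors come from the sup bound and the L^1 bound of [probe]. *)
Lemma probe_le_Lnorm (r : \bar R) (v : field R) : (1 < r)%E -> L2_field v ->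
  (`|\int[torus]_x (v 1 x * probe n N x)|%:E <=
   'N[torus]_r [EFin \o block_norm chi (level n) v] *
   ((8 * N%:R ^+ 3) `^ (three_over r / 3) *
    (5 * (2 * pi) ^+ 3) `^ (1 - three_over r / 3))%:E)%E.
Proof.
move=> r1 v2; rewrite -Re_block_probe//.
apply: Lnorm_duality => //.
- exact: measurable_Re_block.
- exact: measurable_block_norm.
- exact: measurable_probe.
- apply: integrable_Re_block_bounded => //; first exact: measurable_probe.
  exact: probe_le.
- by move=> x; exact: Re_block_le_norm.
- exact: probe_le.
- exact: probe_L1.
Qed.

End packet_pairing.

(** * Series of packets *)

Section L2_series.
Context {R : realType}.
Local Notation E := (R * R * R)%type.
Local Notation mR := (measurableTypeR R).
Local Notation mE := (mR * mR * mR)%type.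

Lemma geometric_sum_le (C rho : R) (n : nat) : 0 <= C -> 0 < rho < 1 ->
  \sum_(0 <= j < n) C * rho ^+ j <= C / (1 - rho).
Proof.
move=> C0 /andP[r0 r1].
have := @geometric_le_lim R n C rho C0 r0; rewrite gtr0_norm//; apply.
exact: r1.
Qed.

(** Cauchy-Schwarz with weights: each pair of indices has the defect
    [(p_i a_j - p_j a_i)^2 / (2 p_i p_j) >= 0]. With geometric weights it bounds all partial sums of
    the series at once. *)
Lemma weighted_sqr_sum_le (I : Type) (s : seq I) (p a : I -> R) :
  (forall i, 0 < p i) ->
  (\sum_(i <- s) a i) ^+ 2 <= (\sum_(i <- s) p i) * \sum_(i <- s) a i ^+ 2 / p i.
Proof.
move=> p0; rewrite expr2 !big_distrlr/=.
have h i j : a i * a j <= 2^-1 * (p i * (a j ^+ 2 / p j) + p j * (a i ^+ 2 / p i)).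
  have pi0 := p0 i; have pj0 := p0 j.
  have -> : 2^-1 * (p i * (a j ^+ 2 / p j) + p j * (a i ^+ 2 / p i)) =
      a i * a j + (p i * a j - p j * a i) ^+ 2 / (2 * (p i * p j)).
    by field; rewrite !gt_eqF.
  by rewrite lerDl divr_ge0 ?sqr_ge0// !mulr_ge0// ltW.
apply: le_trans (_ : _ <= \sum_(i <- s) \sum_(j <- s)
    2^-1 * (p i * (a j ^+ 2 / p j) + p j * (a i ^+ 2 / p i))) _.
  by apply: ler_sum => i _; apply: ler_sum => j _.
rewrite (eq_bigr (fun i => 2^-1 * (\sum_(j <- s) p i * (a j ^+ 2 / p j) +
    \sum_(j <- s) p j * (a i ^+ 2 / p i)))); last first.
  by move=> i _; rewrite -big_split/= mulr_sumr.
rewrite -mulr_sumr big_split/= [X in _ * (_ + X)]exchange_big/=.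
by move: (\sum_(i <- s) \sum_(j <- s) _) => X; lra.
Qed.

Lemma bounded_series_cvg (a : nat -> R) (M : R) :
  (forall n, \sum_(0 <= j < n) `|a j| <= M) -> cvgn (series a).
Proof.
move=> aM; apply: normed_cvg; apply: nondecreasing_is_cvgn.
  move=> m n mn; rewrite /= /series/= (big_cat_nat (leq0n m) mn)/= lerDl.
  by rewrite sumr_ge0.
by exists M => _ [n _ <-]; exact: aM.
Qed.

Variables (f : nat -> E -> R) (C rho : R).
Hypotheses (C0 : 0 <= C) (rho01 : 0 < rho < 1).
Hypotheses (pf : forall j, periodic (f j))
  (mf : forall j, measurable_fun [set: mE] (f j : mE -> mR))
  (f2 : forall j, (\int[torus]_x (f j x ^+ 2)%:E <= (C * (rho ^+ j * rho ^+ j))%:E)%E).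

Let rho_gt0 j : 0 < rho ^+ j. Proof. by case/andP: rho01 => r0 _; rewrite exprn_gt0. Qed.

(* The weights [rho ^+ j] make the sum of the integrals finite, so [W] is
   finite almost everywhere; the series is replaced by 0 where it is not. *)
Let W (x : mE) : \bar R := (\sum_(0 <= j <oo) (f j x ^+ 2 / rho ^+ j)%:E)%E.

Let w0 j x : (0 <= (f j x ^+ 2 / rho ^+ j)%:E)%E.
Proof. by rewrite lee_fin divr_ge0 ?sqr_ge0// ltW. Qed.

Let mw j : measurable_fun setT (fun x : mE => (f j x ^+ 2 / rho ^+ j)%:E).
Proof.
by apply/measurable_EFinP; apply: measurable_funM => //; apply: measurable_funX; exact: mf.
Qed.

Let mW : measurable_fun setT W.
Proof. by apply: ge0_emeasurable_sum => j *; [exact: w0|exact: mw]. Qed.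

Let W0 x : (0 <= W x)%E. Proof. by apply: nneseries_ge0 => j *; exact: w0. Qed.

Let intW : (\int[torus]_x W x < +oo)%E.
Proof.
rewrite integral_nneseries//.
apply: (@le_lt_trans _ _ (C / (1 - rho))%:E); last exact: ltry.
apply: lime_le.
  apply: is_cvg_nneseries => j _ _; apply: integral_ge0 => x _; exact: w0.
apply: nearW => n; apply: (@le_trans _ _ (\sum_(0 <= j < n) (C * rho ^+ j)%:E)%E).
  apply: lee_sum => j _.
  under eq_integral do rewrite mulrC EFinM.
  rewrite ge0_integralZl//.
  - rewrite muleC lee_pdivrMr//; apply: le_trans (f2 j) _.
    by rewrite -EFinM lee_fin mulrA.
  - by apply/measurable_EFinP; apply: measurable_funX; exact: mf.
  - by move=> x _; rewrite lee_fin sqr_ge0.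
  - by rewrite lee_fin invr_ge0 ltW.
by rewrite sumEFin lee_fin geometric_sum_le.
Qed.

Let iW : torus.-integrable setT W.
Proof.
apply/integrableP; split => //.
by under eq_integral do rewrite gee0_abs//.
Qed.

Let A : set mE := ~` (W @^-1` [set +oo%E]).

Let mA : measurable A.
Proof.
apply: measurableC; rewrite -[X in measurable X]setTI; apply: mW => //.
Qed.

Let finW x : A x -> (W x = (fine (W x))%:E)%E.
Proof.
move=> Ax; rewrite fineK// ge0_fin_numE// ltey; apply/eqP => Wx; exact: Ax.
Qed.

Let aeA : \forall x \ae torus, A x.
Proof.
have := integrable_ae measurableT iW; apply: filterS => x /= /(_ I) Wx WNx.
by move: Wx; rewrite WNx.
Qed.

Let S n x := \sum_(0 <= j < n) f j x.

Let part_le n x : A x -> \sum_(0 <= j < n) f j x ^+ 2 / rho ^+ j <= fine (W x).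
Proof.
move=> Ax; rewrite -lee_fin -finW// -sumEFin.
by apply: nneseries_lim_ge => j *; exact: w0.
Qed.

Let D := (1 - rho)^-1.

Let D0 : 0 < D.
Proof. by rewrite invr_gt0 subr_gt0; case/andP: rho01. Qed.

Let rho_sum n : \sum_(0 <= j < n) rho ^+ j <= D.
Proof.
have := @geometric_sum_le 1 rho n ler01 rho01; rewrite div1r.
by under eq_bigr do rewrite mul1r.
Qed.

Let sqrS_le n x : A x -> S n x ^+ 2 <= D * fine (W x).
Proof.
move=> Ax; apply: le_trans (weighted_sqr_sum_le _ _ rho_gt0) _.
apply: ler_pM => //; last exact: part_le.
  by apply: sumr_ge0 => j _; exact: ltW.
by apply: sumr_ge0 => j _; rewrite -lee_fin; exact: w0.
Qed.

Let cvgS x : A x -> cvgn (S ^~ x).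
Proof.
move=> Ax; apply: (@bounded_series_cvg (f ^~ x) (D + fine (W x))) => n.
apply: (@le_trans _ _ (\sum_(0 <= j < n) (rho ^+ j + f j x ^+ 2 / rho ^+ j))).
  apply: ler_sum => j _; have := rho_gt0 j; move: (rho ^+ j) => p p0.
  have -> : f j x ^+ 2 / p = `|f j x| ^+ 2 / p by rewrite real_normK ?num_real.
  move: `|f j x| (normr_ge0 (f j x)) => a a0.
  rewrite -(ler_pM2r p0) mulrDl mulfVK ?gt_eqF//.
  by have := sqr_ge0 (p - a); rewrite !expr2; nra.
by rewrite big_split/= lerD ?part_le.
Qed.

Let F x : R := \1_A x * limn (S ^~ x).

Let cvgF x : (fun n => \1_A x * S n x) @ \oo --> F x.
Proof.
have [Ax|nAx] := pselect (A x).
  by apply: cvgM; [exact: cvg_cst|exact: cvgS].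
rewrite /F indicE memNset// mul0r.
by under eq_fun do rewrite mul0r; exact: cvg_cst.
Qed.

Let mS n : measurable_fun [set: mE] (S n : mE -> mR).
Proof. exact: measurable_sum. Qed.

Let mF : measurable_fun [set: mE] (F : mE -> mR).
Proof.
apply: (@measurable_fun_cvg _ mE R setT (fun n x => \1_A x * S n x)) => [n|x _].
  by apply: measurable_funM; [exact: measurable_indic|exact: mS].
exact: cvgF.
Qed.

Let F2 x : A x -> F x ^+ 2 <= D * fine (W x).
Proof.
move=> Ax; have := @cvgF x; rewrite {1}indicE mem_set// => cF.
have : (fun n => (1 * S n x) ^+ 2) @ \oo --> F x ^+ 2.
  by rewrite expr2; under eq_fun do rewrite expr2; exact: cvgM.
move=> /(@cvgr_to_le _ _ _ _ _) h; apply: h; apply: nearW => n.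
by rewrite mul1r sqrS_le.
Qed.

(** [L2_fun] demands periodicity at every point, so the exceptional set where the series is replaced
    by 0 has to be periodic and not merely null. *)
Let periodic_W i x : W (x + (2 * pi) *: basis i) = W x.
Proof. by apply: eq_eseriesr => j _; rewrite pf. Qed.

Let pF : periodic F.
Proof.
move=> i x; rewrite /F !indicE.
have -> : S ^~ (x + (2 * pi) *: basis i) = S ^~ x.
  by apply/funext => n; apply: eq_bigr => j _; rewrite pf.
have -> // : (x + (2 * pi) *: basis i \in A) = (x \in A).
have Ap : A (x + (2 * pi) *: basis i) = A x.
  exact: (congr1 (fun z => ~ (z = +oo%E)) (periodic_W i x)).
by apply/idP/idP => /set_mem; [rewrite Ap|rewrite -Ap] => h; exact/mem_set.
Qed.

(** Almost everywhere the partial sums satisfy [|S| <= 1 + S^2 <= 1 + D * W], an integrable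
    majorant, so dominated convergence passes to the limit in the pairing with any [g] bounded on
    the cell. With waves for [g] this determines the Fourier coefficients of the sum. *)
Lemma L2_series : exists F : E -> R, L2_fun F /\
  forall (g : mE -> R) (M : R), measurable_fun setT g ->
    (forall x, cell x -> `|g x| <= M) ->
    (fun n => \sum_(0 <= j < n) \int[torus]_x (f j x * g x)) @ \oo -->
    \int[torus]_x (F x * g x).
Proof.
exists F; split.
  split => //.
  apply: (@le_lt_trans _ _ (\int[torus]_x (D%:E * W x))%E).
    apply: ae_ge0_le_integral => //.
    - by move=> x _; rewrite lee_fin sqr_ge0.
    - by apply/measurable_EFinP; apply: measurable_funX; exact: mF.
    - by move=> x _; rewrite mule_ge0// lee_fin ltW.
    - exact: emeasurable_funM.
    - by apply: filterS aeA => x Ax _; rewrite finW// -EFinM lee_fin F2.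
  rewrite ge0_integralZl//; last by rewrite lee_fin ltW.
  by rewrite lte_mul_pinfty// lee_fin ltW.
move=> g M mg gM.
have f2y j : (\int[torus]_x (f j x ^+ 2)%:E < +oo)%E.
  by apply: le_lt_trans (f2 j) (ltry _).
have ifg j : torus.-integrable setT (EFin \o ((fun x => f j x * g x) : mE -> R)).
  exact: integrable_L2_bounded (mf j) (f2y j) mg gM.
have M0 : 0 <= M by apply: le_trans (gM (0, 0, 0) _) => //; split; [split|];
  rewrite /= in_itv/= lexx mulr_ge0// pi_ge0.
pose G n (x : mE) := (S n x * g x)%:E.
have [iF _ key] : [/\ torus.-integrable setT (fun x => (F x * g x)%:E),
    [sequence (\int[torus]_x `|G n x - (F x * g x)%:E|)%E]_n @ \oo --> 0%E &
    [sequence (\int[torus]_x G n x)%E]_n @ \oo --> (\int[torus]_x (F x * g x)%:E)%E].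
  apply: (@dominated_convergence _ mE R torus setT measurableT G
     (fun x => (F x * g x)%:E) (fun x => M%:E * (1 + D%:E * W x))%E) => //.
  - by move=> n; apply/measurable_EFinP; apply: measurable_funM => //; exact: mS.
  - by apply/measurable_EFinP; apply: measurable_funM.
  - apply: filterS aeA => x Ax _; apply/fine_cvgP; split; first exact: nearW.
    have := @cvgF x; rewrite indicE mem_set// => cF.
    apply: cvgM; last exact: cvg_cst.
    by under eq_fun do rewrite -[S _ x]mul1r.
  - apply: integrableZl => //; apply: integrableD => //.
      exact: (integrable_torus_cst 1).
    exact: integrableZl.
  - have : \forall x \ae torus, (cell : set mE) x by exact: ae_torus_cell.
    apply: filterS2 aeA => x Ax cx n _; rewrite /G finW//.
    rewrite -[leRHS]/((M * (1 + D * fine (W x)))%:E) lee_fin normrM mulrC.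
    rewrite ler_pM ?gM//.
    apply: le_trans (_ : _ <= 1 + S n x ^+ 2) _; last by rewrite lerD2l sqrS_le.
    rewrite -[S n x ^+ 2]real_normK ?num_real//.
    by have := sqr_ge0 (1 - `|S n x|); have := normr_ge0 (S n x); rewrite !expr2; nra.
have -> : (fun n => \sum_(0 <= j < n) \int[torus]_x (f j x * g x)) =
    fine \o [sequence (\int[torus]_x G n x)%E]_n.
  apply/funext => n /=; rewrite -Rintegral_sum//; congr fine.
  by apply: eq_integral => x _; rewrite /G mulr_suml.
apply: fine_cvg; rewrite fineK//; exact: integrable_fin_num iF.
Qed.

End L2_series.

Section packet_blocks.
Context {R : realType}.
Local Notation E := (R * R * R)%type.
Local Notation mR := (measurableTypeR R).
Local Notation mE := (mR * mR * mR)%type.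
Local Notation K := (int * int * int)%type.
Local Notation T N := ('I_N * 'I_N * 'I_N)%type.
Implicit Types (k l : K) (x : E) (q : int).

Variable chi : E -> R.
Hypothesis hchi : besov_cutoff chi.

Lemma coef_packet_other q n N (i : 'I_3) k (c : R) : (0 < N)%N -> (N <= 2 ^ n)%N ->
  -1 <= q -> q != level n -> phi_ chi q (freq k) != 0 ->
  coef (packet n N i) k c = 0.
Proof.
move=> N0 Nn q1 qn phik; rewrite /packet coef_waves big1 ?mulr0// => d _.
have mphi : phi_ chi q (freq (mode n d)) = 0.
  by apply: (phi_other hchi (q := level n)) => //; exact: mode_level.
have -> : (k == mode n d) = false.
  by apply: contraNF phik => /eqP ->; rewrite mphi.
have -> : (k == - mode n d) = false.
  by apply: contraNF phik => /eqP ->; rewrite (phi_even hchi) mphi.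
by rewrite addr0 mulr0.
Qed.

Lemma block_packet n N (i : 'I_3) (a : R) x : (0 < N)%N -> (N <= 2 ^ n)%N ->
  block chi (level n) (fun y => a * packet n N i y) x = (a * packet n N i x)%:C%C.
Proof.
move=> N0 Nn.
have -> : (fun y => a * packet n N i y) =
    (fun y => \sum_(c : T N) (a * polar (mode n c) i) * wave (mode n c) 0 y).
  by apply/funext => y; rewrite mulr_sumr; apply: eq_bigr => c _; rewrite mulrA.
rewrite (block_waves hchi); congr (_%:C)%C; rewrite mulr_sumr; apply: eq_bigr => c _.
by rewrite phi_self//; [rewrite mulr1 mulrA|exact: mode_level].
Qed.

Lemma block_norm_real q (v w : field R) x :
  (forall i, block chi q (v i) x = (w i x)%:C%C) ->
  block_norm chi q v x = Num.sqrt (\sum_i w i x ^+ 2).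
Proof.
move=> vw; rewrite /block_norm; congr Num.sqrt; apply: eq_bigr => i _.
by rewrite vw /= expr0n/= addr0 sqrtr_sqr real_normK// num_real.
Qed.

Definition packet_norm (a : R) n N x := Num.sqrt (\sum_i (a * packet n N i x) ^+ 2).

Lemma packet_norm_ge0 a n N x : 0 <= packet_norm a n N x.
Proof. exact: sqrtr_ge0. Qed.

Lemma packet_norm_le a n N x : (0 < N)%N -> (N <= 2 ^ n)%N -> 0 <= a ->
  packet_norm a n N x <= 2 * (a * N%:R ^+ 3).
Proof.
move=> N0 Nn a0; have A0 : 0 <= a * N%:R ^+ 3 by rewrite mulr_ge0// exprn_ge0.
rewrite -[leRHS]ger0_norm ?mulr_ge0// -sqrtr_sqr ler_sqrt ?sqr_ge0//.
have h i : (a * packet n N i x) ^+ 2 <= (a * N%:R ^+ 3) ^+ 2.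
  rewrite -[leLHS]real_normK ?num_real// lerXn2r ?nnegrE// normrM ger0_norm//.
  by rewrite ler_wpM2l// packet_le.
rewrite sum3; have := h 0; have := h 1; have := h 2.
have := sqr_ge0 (a * N%:R ^+ 3).
by rewrite [(2 * _) ^+ 2]exprMn; move: ((a * N%:R ^+ 3) ^+ 2) => y *; lra.
Qed.

Lemma measurable_packet_norm a n N :
  measurable_fun [set: mE] (packet_norm a n N : mE -> mR).
Proof.
apply: measurableT_comp; first exact: measurable_sqrt.
apply: measurable_sum => i; apply: measurable_funX; apply: measurable_funM => //.
exact: measurable_packet.
Qed.

Lemma packet_norm_sqr a n N : (0 < N)%N -> (N <= 2 ^ n)%N ->
  (\int[torus]_x (packet_norm a n N x ^+ 2)%:E <=
   (3 * a ^+ 2 * ((2 * pi) ^+ 3 * N%:R ^+ 3))%:E)%E.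
Proof.
move=> N0 Nn.
have p2 i := packet_sqr (R := R) N0 Nn i.
have ip i : torus.-integrable setT (EFin \o ((fun x => packet n N i x ^+ 2) : mE -> R)).
  apply: (@integrable_sqr R (packet n N i)); first exact: measurable_packet.
  exact: le_lt_trans (p2 i) (ltry _).
under eq_integral.
  move=> x _; rewrite sqr_sqrtr; last by apply: sumr_ge0 => i _; exact: sqr_ge0.
  under eq_bigr do rewrite exprMn.
  over.
rewrite integrable_Rintegral; last first.
  by apply: integrable_torus_sum => i; exact: integrable_torusZ.
rewrite Rintegral_sum => [|i]; last exact: integrable_torusZ.
rewrite lee_fin; under eq_bigr do rewrite RintegralZl//.
have h i : \int[torus]_x (packet n N i x ^+ 2) <= (2 * pi) ^+ 3 * N%:R ^+ 3 :> R.
  by have := p2 i; rewrite (integrable_Rintegral (ip i)) lee_fin.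
rewrite sum3 -!mulrDr -mulrA mulrCA ler_wpM2l ?sqr_ge0//.
by have := h 0; have := h 1; have := h 2; lra.
Qed.

Lemma L2_funB (f g : E -> R) : L2_fun f -> L2_fun g -> L2_fun (fun x => f x - g x).
Proof.
move=> [pf mf f2] [pg mg g2]; split.
- by move=> i x; rewrite pf pg.
- exact: measurable_funB.
- have iS : torus.-integrable setT (EFin \o ((fun x => 2 * (f x ^+ 2 + g x ^+ 2)) : mE -> R)).
    by apply: integrable_torusZ; apply: integrable_torusD; exact: integrable_sqr.
  apply: (@le_lt_trans _ _ (\int[torus]_x (2 * (f x ^+ 2 + g x ^+ 2))%:E)%E).
    apply: ge0_le_integral => //.
    + by move=> x _; rewrite lee_fin sqr_ge0.
    + by apply/measurable_EFinP; apply: measurable_funX; exact: measurable_funB.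
    + by case/integrableP : iS.
    + move=> x _; rewrite lee_fin; have := sqr_ge0 (f x + g x).
      by rewrite !expr2; nra.
  by rewrite integrable_Rintegral// ltry.
Qed.

End packet_blocks.

(** * The initial field and its Besov norm *)

Section rough_field.
Context {R : realType}.
Local Notation E := (R * R * R)%type.
Local Notation mR := (measurableTypeR R).
Local Notation mE := (mR * mR * mR)%type.
Local Notation K := (int * int * int)%type.
Implicit Types (k l : K) (x : E) (q : int).

Lemma gt0_powRD (x y z : R) : 0 < x -> x `^ (y + z) = x `^ y * x `^ z.
Proof. by move=> x0; apply: powRD; apply/implyP => _; rewrite gt_eqF. Qed.

Lemma powR2N_lt1 (e : R) : 0 < e -> 0 < 2 `^ (- e) < 1.
Proof.
move=> e0; rewrite powR_gt0//= /powR pnatr_eq0/= expR_lt1 mulNr oppr_lt0.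
by rewrite mulr_gt0// ln_gt0// ltr1n.
Qed.

Lemma powRX (x e : R) n : 0 <= x -> (x ^+ n) `^ e = (x `^ e) ^+ n.
Proof. by move=> x0; rewrite -powR_mulrn// -powRAC powR_mulrn// powR_ge0. Qed.

Lemma level_inj : injective level.
Proof. by move=> m n [] /addIn. Qed.

Lemma cvg_eventually_eq (f : nat -> R) (l c : R) n :
  f @ \oo --> l -> (forall m, (n < m)%N -> f m = c) -> l = c.
Proof.
move=> fl fc; apply: (cvg_unique (@Rhausdorff R) fl); apply: cvg_near_cst.
by near=> m; apply: fc; near: m; exact: nbhs_infty_gt.
Unshelve. all: by end_near. Qed.

Variable chi : E -> R.
Hypothesis hchi : besov_cutoff chi.
Variables (r : \bar R) (s : R) (al : bool).
Local Notation sg := (three_over r).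
Hypotheses (r1 : (1 < r)%E) (al2 : al -> (2%:E <= r)%E).
(* [al] selects the concentrated packets.  The first exponent makes the L^2
   norms of the packets summable, the second one lets them dominate H^1. *)
Hypothesis e1_gt0 : 0 < s - al%:R * (sg - 3 / 2).
Hypothesis e2_gt0 : 0 < 1 - s - al%:R * (3 / 2 - sg).

Let P : R := (2 * pi) ^+ 3.
Let P0 : 0 < P. Proof. by rewrite exprn_gt0// mulr_gt0// pi_gt0. Qed.

(** The factor in [probe_le_Lnorm] is [Q * N^sg]. *)
Let Q : R := 8 `^ (sg / 3) * (5 * P) `^ (1 - sg / 3).
Let Q0 : 0 < Q. Proof. by rewrite mulr_gt0// powR_gt0// mulr_gt0. Qed.

(** Chosen so that [B * P / 2 = 2 * Q]: after multiplication by [lambda^s], the pairing of the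
    initial field with the probe is twice the duality factor [Q * N^sg]. One copy absorbs the H^1
    part, the other gives the lower bound 1. *)
Let B : R := 4 * Q / P.
Let B0 : 0 < B. Proof. by rewrite divr_gt0// mulr_gt0. Qed.

Let N n : nat := if al then (2 ^ n)%N else 1%N.

Let N0 n : (0 < N n)%N. Proof. by rewrite /N; case: al; rewrite ?expn_gt0. Qed.
Let Nn n : (N n <= 2 ^ n)%N. Proof. by rewrite /N; case: al; rewrite ?expn_gt0. Qed.

Let L n : R := 2 ^+ n.
Let L0 n : 0 < L n. Proof. by rewrite exprn_gt0. Qed.

Let NE n : (N n)%:R = L n `^ al%:R :> R.
Proof. by rewrite /N /L; case: al; rewrite ?powRr1 ?natrX ?powRr0// ltW. Qed.

Let NR0 n : 0 < (N n)%:R :> R. Proof. by rewrite ltr0n. Qed.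

Let NX n e : (N n)%:R `^ e = L n `^ (al%:R * e) :> R.
Proof. by rewrite NE powRrM. Qed.

Let lamX n e : lambda (level n) `^ e = 16 `^ e * L n `^ e :> R.
Proof. by rewrite lambda_level powRM// ltW. Qed.

Let lamV n : lambda (level n) `^ s * lambda (level n) `^ (- s) = 1 :> R.
Proof. by rewrite -gt0_powRD ?lambda_gt0// subrr powRr0. Qed.

(** An unscaled packet has L^r norm of order [N^(3 - sg)]; this amplitude makes [lambda^s] times the
    block norm comparable to a constant. *)
Let a n : R := B * (lambda (level n) `^ (- s) * (N n)%:R `^ (sg - 3)).

Let a0 n : 0 < a n.
Proof.
apply: mulr_gt0 => //; apply: mulr_gt0; rewrite powR_gt0//; exact: lambda_gt0.
Qed.

Let aN3 n : lambda (level n) `^ s * (a n * (N n)%:R ^+ 3) = B * (N n)%:R `^ sg.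
Proof.
rewrite -(powR_mulrn 3) ?ltW//.
have -> : (N n)%:R `^ sg = (N n)%:R `^ (sg - 3) * (N n)%:R `^ 3%:R :> R.
  by rewrite -gt0_powRD// subrK.
rewrite /a; have := lamV n; move: (lambda _ `^ s) (lambda _ `^ - s) => y z yz.
by rewrite -[RHS]mul1r -yz; ring.
Qed.

(** The L^2 norm of the scaled packet of level [n] is bounded by a constant times [rho ^+ n]. *)
Let rho : R := 2 `^ (- (s - al%:R * (sg - 3 / 2))).

Let rho01 : 0 < rho < 1. Proof. exact: powR2N_lt1. Qed.

Let a2N3 n : a n ^+ 2 * (N n)%:R ^+ 3 =
  (B ^+ 2 * (16 `^ (- s)) ^+ 2) * (rho ^+ n * rho ^+ n).
Proof.
have -> : rho ^+ n = L n `^ (- (s - al%:R * (sg - 3 / 2))) by rewrite /L powRX.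
rewrite -gt0_powRD// -(powR_mulrn 3) ?ltW// /a !NX lamX !expr2.
have -> : - (s - al%:R * (sg - 3 / 2)) + - (s - al%:R * (sg - 3 / 2)) =
  - s + - s + (al%:R * (sg - 3) + al%:R * (sg - 3)) + al%:R * 3 by field.
rewrite !gt0_powRD//; ring.
Qed.

Let pk n (i : 'I_3) x : R := a n * packet n (N n) i x.

Let series_field : exists u0 : field R, forall i, L2_fun (u0 i) /\
  forall (g : mE -> R) (M : R), measurable_fun setT g ->
    (forall x, cell x -> `|g x| <= M) ->
    (fun n => \sum_(0 <= j < n) \int[torus]_x (pk j i x * g x)) @ \oo -->
    \int[torus]_x (u0 i x * g x).
Proof.
suff h : forall i : 'I_3, exists F : E -> R, L2_fun F /\
  forall (g : mE -> R) (M : R), measurable_fun setT g ->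
    (forall x, cell x -> `|g x| <= M) ->
    (fun n => \sum_(0 <= j < n) \int[torus]_x (pk j i x * g x)) @ \oo -->
    \int[torus]_x (F x * g x).
  by have [F FP] := choice h; exists F.
move=> i; apply: (@L2_series _ (fun j => pk j i) (P * (B ^+ 2 * (16 `^ (- s)) ^+ 2)) rho) => //.
- by rewrite mulr_ge0 ?ltW// mulr_gt0 ?exprn_gt0// powR_gt0.
- by move=> j k x; rewrite /pk periodic_packet.
- by move=> j; apply: measurable_funM => //; exact: measurable_packet.
move=> j; have p2 := @packet_sqr R _ _ (N0 j) (Nn j) i.
under eq_integral do rewrite exprMn EFinM.
have mp2 : measurable_fun setT (fun x : mE => (packet j (N j) i x ^+ 2 : R)%:E).
  by apply/measurable_EFinP; apply: measurable_funX; exact: measurable_packet.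
rewrite (@ge0_integralZl _ _ _ torus setT measurableT _ mp2) => [|x _|]; last 2 first.
- by rewrite lee_fin sqr_ge0.
- by rewrite lee_fin sqr_ge0.
by rewrite -mulrA -a2N3 [P * _]mulrCA [leRHS]EFinM lee_wpmul2l// lee_fin sqr_ge0.
Qed.

(** For r = oo the sup bound suffices. For finite r, a concentrated packet has [r >= 2], and its
    norm is interpolated between L^2 and the sup bound; otherwise the packet is a single wave, and
    the sup bound on a space of finite measure is enough. *)
Let Lnorm_packet : exists C, forall n, (((lambda (level n)) `^ s)%:E *
  'N[torus]_r [EFin \o packet_norm (a n) n (N n)] <= C%:E)%E.
Proof.
have fA n x : `|packet_norm (a n) n (N n) x| <= 2 * (a n * (N n)%:R ^+ 3).
  by rewrite ger0_norm ?packet_norm_ge0// packet_norm_le// ltW.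
have lam0 n : (0 <= ((lambda (level n)) `^ s)%:E :> \bar R)%E by rewrite lee_fin powR_ge0.
have y0 n : 0 < a n * (N n)%:R ^+ 3 by rewrite mulr_gt0// exprn_gt0.
case: r r1 al2 aN3 fA => [p| |]// p1 p2 aN fA; last first.
  exists (2 * B) => n; apply: le_trans (lee_wpmul2l (lam0 n) (Lnormy_le (fA n))) _.
  by rewrite -EFinM lee_fin mulrCA aN /= powRr0 mulr1.
rewrite lte_fin in p1; have p0 : 0 < p by exact: lt_trans p1.
have [alT|alF] := boolP al.
  exists (2 `^ (1 - 2 / p) * (3 * P) `^ p^-1 * B) => n.
  have {}p2 : (0 < 2 :> R) && (2 <= p) by rewrite ltr0n/= -lee_fin p2.
  have := Lnorm_interpolation p2 (measurable_packet_norm (a n) n (N n)) (fA n).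
  move=> /(_ (3 * a n ^+ 2 * (P * (N n)%:R ^+ 3))) h.
  apply: le_trans (lee_wpmul2l (lam0 n) (h _)) _.
    under eq_integral do rewrite powR_mulrn// real_normK ?num_real//.
    exact: packet_norm_sqr.
  rewrite -EFinM lee_fin.
  set y := a n * (N n)%:R ^+ 3.
  have -> : 3 * a n ^+ 2 * (P * (N n)%:R ^+ 3) = (3 * P) * (y `^ 2%:R * (N n)%:R `^ - 3).
    have -> : ((N n)%:R : R) `^ (- 3) = (N n)%:R ^- 3 by rewrite powRN powR_mulrn// ltW.
    rewrite (powR_mulrn 2 (ltW (y0 n))); have := NR0 n; rewrite /y.
    by move: (N n)%:R => z z0; field; rewrite gt_eqF.
  have E1 : (2 * y) `^ (1 - 2 / p) * (3 * P * (y `^ 2%:R * (N n)%:R `^ - 3)) `^ p^-1 =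
      2 `^ (1 - 2 / p) * (3 * P) `^ p^-1 * (y * (N n)%:R `^ (- (3 / p))).
    have y0' : 0 <= y by exact/ltW/y0.
    have P3 : 0 <= 3 * P by exact/ltW/mulr_gt0.
    rewrite powRM// [X in _ * X]powRM//; last by rewrite mulr_ge0 ?powR_ge0.
    rewrite [(y `^ _ * _) `^ _]powRM ?powR_ge0// -!powRrM mulNr.
    have yE : y `^ (1 - 2 / p) * y `^ (2%:R / p) = y.
      by rewrite -gt0_powRD ?y0// subrK powRr1.
    by rewrite -[in RHS]yE; ring.
  have E2 : lambda (level n) `^ s * (y * (N n)%:R `^ (- (3 / p))) = B.
    by rewrite mulrA aN -mulrA -gt0_powRD// subrr powRr0 mulr1.
  by rewrite E1 mulrCA E2.
have N1 : N = fun=> 1%N by rewrite /N (negbTE alF).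
exists (2 * B * P `^ p^-1) => n.
have p2' : (0 < 1 :> R) && (1 <= p) by rewrite ltr01 ltW.
have := Lnorm_interpolation p2' (measurable_packet_norm (a n) n (N n)) (fA n).
set y := a n * (N n)%:R ^+ 3.
move=> /(_ (2 * y * P)) h.
apply: le_trans (lee_wpmul2l (lam0 n) (h _)) _.
  apply: (@le_trans _ _ (\int[torus]_x cst (2 * y)%:E x)%E).
    apply: ge0_le_integral => //.
    - apply/measurable_EFinP.
      apply: (@measurableT_comp _ _ _ _ _ _ (@powR R ^~ 1)) => //.
      by apply: measurableT_comp => //; exact: measurable_packet_norm.
    - by move=> x _; rewrite lee_fin powRr1//; exact: fA.
  by rewrite integral_cst// [X in (_ * X)%E]torusT -EFinM.
have y0' : 0 <= y by exact/ltW/y0.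
have y2 : 0 <= 2 * y by rewrite mulr_ge0.
rewrite -EFinM lee_fin [X in _ * (_ * X)]powRM ?(ltW P0)// mulrA.
have yE : (2 * y) `^ (1 - 1 / p) * (2 * y) `^ p^-1 = 2 * y.
  have y2' : 0 < 2 * y by rewrite mulr_gt0 ?y0.
  by rewrite -(gt0_powRD _ _ y2') div1r subrK powRr1.
have -> : lambda (level n) `^ s * (2 * y) `^ (1 - 1 / p) * ((2 * y) `^ p^-1 * P `^ p^-1) =
    (2 * (lambda (level n) `^ s * y)) * P `^ p^-1.
  by rewrite [RHS]mulrAC -mulrA [X in _ * X]mulrA yE; ring.
by rewrite aN /= N1 powR1 mulr1.
Qed.

Let integrable_packet n i (g : mE -> R) (M : R) : measurable_fun setT g ->
  (forall x, cell x -> `|g x| <= M) ->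
  torus.-integrable setT (EFin \o ((fun x => packet n (N n) i x * g x) : mE -> R)).
Proof.
move=> mg gM; apply: (@integrable_L2_bounded _ _ _ M) => //.
- exact: measurable_packet.
- by apply: le_lt_trans (packet_sqr (N0 n) (Nn n) i) _; rewrite ltry.
Qed.

Let integrable_pk n i (g : mE -> R) (M : R) : measurable_fun setT g ->
  (forall x, cell x -> `|g x| <= M) ->
  torus.-integrable setT (EFin \o ((fun x => pk n i x * g x) : mE -> R)).
Proof.
move=> mg gM.
rewrite (_ : (fun x => _) = (fun x => a n * (packet n (N n) i x * g x))).
  by apply: integrable_torusZ; exact: integrable_packet gM.
by apply/funext => x; rewrite mulrA.
Qed.

Let integral_pk n i (g : mE -> R) (M : R) : measurable_fun setT g ->
  (forall x, cell x -> `|g x| <= M) ->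
  \int[torus]_x (pk n i x * g x) = a n * \int[torus]_x (packet n (N n) i x * g x).
Proof.
move=> mg gM; under eq_Rintegral do rewrite -mulrA.
by rewrite RintegralZl//; exact: integrable_packet gM.
Qed.

Section series_properties.
Variable u0 : field R.
Hypothesis u0P : forall i, L2_fun (u0 i) /\
  forall (g : mE -> R) (M : R), measurable_fun setT g ->
    (forall x, cell x -> `|g x| <= M) ->
    (fun n => \sum_(0 <= j < n) \int[torus]_x (pk j i x * g x)) @ \oo -->
    \int[torus]_x (u0 i x * g x).

Let coef_u0 i k c :
  (fun n => \sum_(0 <= j < n) (a j * coef (packet j (N j) i) k c)) @ \oo --> coef (u0 i) k c.
Proof.
have w1 x : cell x -> `|wave k c x| <= 1 by move=> _; exact: wave_le1.
have mw : measurable_fun [set: mE] (wave k c : mE -> mR) by exact: measurable_wave.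
have := (u0P i).2 _ _ mw w1; apply: cvg_trans; apply: near_eq_cvg; near=> n.
by apply: eq_bigr => j _; rewrite (integral_pk _ _ mw w1).
Unshelve. all: by end_near. Qed.

Let coef_u0_eq i k c n (l : R) :
  (forall m, (n < m)%N -> \sum_(0 <= j < m) a j * coef (packet j (N j) i) k c = l) ->
  coef (u0 i) k c = l.
Proof. by move=> ml; exact: (cvg_eventually_eq (@coef_u0 i k c) ml). Qed.

(** Packets of other levels have no frequency in the support of this multiplier, so a single term of
    the series contributes and the partial sums are constant once it is included. *)
Let coef_level n i k c : phi_ chi (level n) (freq k) != 0 ->
  coef (u0 i) k c = coef (pk n i) k c.
Proof.
move=> phik; have w1 x : cell x -> `|wave k c x| <= 1 by move=> _; exact: wave_le1.
have mw : measurable_fun [set: mE] (wave k c : mE -> mR) by exact: measurable_wave.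
rewrite [RHS](integral_pk _ _ mw w1) -/(coef _ k c).
apply: (@coef_u0_eq _ _ _ n) => m nm; rewrite big_mkord (bigD1 (Ordinal nm))//=.
rewrite big1 ?addr0// => j jn; rewrite (coef_packet_other hchi (q := level n)) ?mulr0//.
by rewrite (inj_eq level_inj) eq_sym.
Qed.

Let coef_nonlevel q i k c : -1 <= q -> (forall n, q != level n) ->
  phi_ chi q (freq k) != 0 -> coef (u0 i) k c = 0.
Proof.
move=> q1 qn phik; apply: (@coef_u0_eq _ _ _ 0%N) => m _.
by rewrite big1// => j _; rewrite (coef_packet_other hchi (q := q)) ?mulr0.
Qed.

Let L2_u0 : L2_field u0. Proof. by move=> i; case: (u0P i). Qed.

Let div_free_u0 : div_free u0.
Proof.
move=> psi ppsi spsi.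
have cD i : continuous ('D_(basis i) psi) by have [] := spsi [:: basis i].
have [M DM] := choice (fun i => continuous_cell_bounded (cD i)).
have mD i := continuous_measurable3 (cD i).
have cv i := (u0P i).2 _ _ (mD i) (DM i).
have := cvgD (cvgD (cv 0) (cv 1)) (cv 2).
rewrite sum3 => lim3; apply: (@cvg_eventually_eq _ _ _ 0%N (lim3 _ _)) => m _; rewrite !fctE -!big_split/= big1// => j _.
have : \sum_i \int[torus]_x (pk j i x * 'D_(basis i) psi x) = 0.
  rewrite (eq_bigr _ (fun i _ => integral_pk j i (mD i) (DM i))) -mulr_sumr.
  by rewrite (packet_div_free (N0 j) (Nn j) ppsi spsi) mulr0.
rewrite sum3; exact.
Qed.

Let block_norm_level n x :
  block_norm chi (level n) u0 x = packet_norm (a n) n (N n) x.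
Proof.
rewrite (block_norm_real (w := pk n)) => // i; rewrite -(block_packet hchi)//.
by apply: (eq_block hchi) => k c; exact: coef_level.
Qed.

Let block_norm_nonlevel q x : -1 <= q -> (forall n, q != level n) ->
  block_norm chi q u0 x = 0.
Proof.
move=> q1 qn; rewrite (block_norm_real (w := fun=> fun=> 0)) => [|i].
  by rewrite big1 ?sqrtr0// => i _; rewrite expr0n.
rewrite [RHS](_ : _ = block chi q (fun=> 0) x); last by rewrite (block0 hchi).
apply: (eq_block hchi) => k c phik.
rewrite (coef_nonlevel _ _ q1 qn phik) /coef.
under eq_Rintegral do rewrite mul0r.
by rewrite Rintegral_cst// mul0r.
Qed.

Let besov_u0 : (besov_norm chi s r u0 < +oo)%E.
Proof.
have [C LC] := Lnorm_packet.
apply: (@le_lt_trans _ _ (maxe C%:E 0)); last by rewrite gt_max !ltry.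
apply: ge_ereal_sup => _ [q q1 <-].
have [[n ->]|qn] := pselect (exists n, q = level n).
  rewrite le_max; apply/orP; left; apply: le_trans (LC n).
  by rewrite (_ : block_norm _ _ _ = packet_norm (a n) n (N n))//; apply/funext.
rewrite (_ : block_norm _ _ _ = cst 0); last first.
  apply/funext => x; apply: block_norm_nonlevel => // n; apply/eqP => qn'.
  by apply: qn; exists n.
by rewrite Lnorm0 ?mule0 ?le_max ?lexx ?orbT// gt_eqF// (lt_trans _ r1).
Qed.

(** The pairing of [w] with the probe is at most [C * N^(3/2) / 2^n], which relative to the size
    [N^sg / lambda^s] of the packet's pairing decays like [eps ^+ n]. The level is picked after [w],
    because [C] contains the squared L^2 norm of [h]. *)
Let besov_lower_bound (w : field R) (h : E -> R) : L2_field w -> weak_deriv 0 (w 1) h ->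
  (1 <= besov_norm chi s r (fun i x => w i x - u0 i x)%R)%E.
Proof.
move=> w2 wh; set v := fun i x => w i x - u0 i x.
have v2 : L2_field v by move=> i; exact: L2_funB.
pose C : R := \int[torus]_x (h x ^+ 2) + P.
pose eps : R := 2 `^ (- (1 - s - al%:R * (3 / 2 - sg))).
have eps01 : 0 < eps < 1 by exact: powR2N_lt1.
have [n small] : exists n, C * 16 `^ s * eps ^+ n <= Q.
  have : C * 16 `^ s * eps ^+ m @[m --> \oo] --> C * 16 `^ s * 0.
    by apply: cvgMr; apply: cvg_expr; rewrite gtr0_norm; case/andP: eps01.
  rewrite mulr0 => /cvgr_le /(_ _ Q0)[n _ /(_ n)] /=; rewrite leqnn => /(_ isT) h1.
  by exists n.
have mprobe := @measurable_probe R n (N n).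
have probeb x : cell x -> `|probe n (N n) x| <= 8 * (N n)%:R ^+ 3.
  by move=> _; exact: probe_le.
have u0_probe : \int[torus]_x (u0 1 x * probe n (N n) x) = a n * (P / 2 * (N n)%:R ^+ 3).
  rewrite -(integral_packet_probe (N0 n) (Nn n)) -(integral_pk n 1 mprobe probeb).
  rewrite integral_mul_probe => [|k]; last first.
    by apply: integrable_waveM; have [_ ? ?] := L2_u0 1.
  rewrite integral_mul_probe => [|k]; last first.
    apply: (@integrable_pk _ _ _ 1) => [|x _]; last exact: wave_le1.
    exact: measurable_wave.
  congr (_ * _); apply: eq_bigr => b _; apply: eq_bigr => c _.
  by apply: coef_level; rewrite phi_self ?oner_neq0//; exact: pmode_level.
have w_probe := weak_deriv_probe_le (N0 n) (Nn n) (w2 1) wh.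
have v_probe := probe_le_Lnorm (N0 n) (Nn n) hchi r1 v2.
have vE : \int[torus]_x (v 1 x * probe n (N n) x) =
    \int[torus]_x (w 1 x * probe n (N n) x) - \int[torus]_x (u0 1 x * probe n (N n) x).
  have it (f : E -> R) : L2_fun f ->
      torus.-integrable setT (EFin \o ((fun x => f x * probe n (N n) x) : mE -> R)).
    by case=> _ mf f2; apply: integrable_L2_bounded probeb.
  under eq_Rintegral do rewrite mulrBl.
  by rewrite RintegralB//; apply: it.
have DE : (8 * (N n)%:R ^+ 3) `^ (sg / 3) * (5 * P) `^ (1 - sg / 3) = Q * (N n)%:R `^ sg.
  rewrite powRM// ?exprn_ge0// -(powR_mulrn 3) ?ltW// -powRrM.
  by rewrite (_ : 3%:R * (sg / 3) = sg) /Q; [rewrite mulrAC|field].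
rewrite DE vE u0_probe in v_probe.
have epsE : (L n) `^ s * ((N n)%:R `^ (3 / 2) / L n) = (N n)%:R `^ sg * eps ^+ n.
  have -> : eps ^+ n = L n `^ (- (1 - s - al%:R * (3 / 2 - sg))) by rewrite /L powRX.
  rewrite (_ : (L n)^-1 = L n `^ (- 1)); last by rewrite powR_inv1// ltW.
  by rewrite !NX -!gt0_powRD//; congr (L n `^ _); field.
have lams : 0 < lambda (level n) `^ s :> R by rewrite powR_gt0 ?lambda_gt0.
have Nsg : 0 < (N n)%:R `^ sg :> R by rewrite powR_gt0.
have aE := aN3 n.
(* The initial field contributes [2 * Q * N^sg] and [w], by the choice of [n], at most [Q * N^sg];
   the reverse triangle inequality leaves one copy. *)
have key : Q * (N n)%:R `^ sg <= lambda (level n) `^ s *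
    `|\int[torus]_x (w 1 x * probe n (N n) x) - a n * (P / 2 * (N n)%:R ^+ 3)|.
  have lower (x y z : R) : `|x| <= z -> y - z <= `|x - y|.
    move=> xz; have := ler_norm (- (x - y)); rewrite normrN.
    by have := ler_norm x; lra.
  apply: le_trans (ler_wpM2l (ltW lams) (lower _ _ _ w_probe)).
  rewrite -/C mulrBr.
  have -> : lambda (level n) `^ s * (a n * (P / 2 * (N n)%:R ^+ 3)) =
      2 * Q * (N n)%:R `^ sg.
    transitivity (P / 2 * (lambda (level n) `^ s * (a n * (N n)%:R ^+ 3))); first by ring.
    by rewrite aE /B; field; rewrite gt_eqF.
  have -> : lambda (level n) `^ s * (C * ((N n)%:R `^ (3 / 2) / 2 ^+ n)) =
      C * 16 `^ s * eps ^+ n * (N n)%:R `^ sg.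
    by rewrite lamX -[RHS]mulrA [eps ^+ n * _]mulrC -epsE /L; ring.
  by rewrite -mulrBl ler_pM2r//; lra.
set X := besov_norm _ _ _ _.
set Y := ('N[torus]_r [_])%E in v_probe.
have YX : ((lambda (level n) `^ s)%:E * Y <= X)%E.
  by apply: ereal_sup_ubound; exists (level n).
apply: le_trans YX.
have QN : 0 < Q * (N n)%:R `^ sg by rewrite mulr_gt0.
rewrite -(@lee_pmul2r _ (Q * (N n)%:R `^ sg)%:E)// mul1e -muleA.
apply: (@le_trans _ _ (lambda (level n) `^ s *
    `|\int[torus]_x (w 1 x * probe n (N n) x) - a n * (P / 2 * (N n)%:R ^+ 3)|)%:E).
  by rewrite lee_fin.
by rewrite EFinM lee_wpmul2l// lee_fin ltW.
Qed.

Lemma rough_series : [/\ L2_field u0, div_free u0, (besov_norm chi s r u0 < +oo)%E &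
  forall (w : field R) (h : E -> R), L2_field w -> weak_deriv 0 (w 1) h ->
  (1 <= besov_norm chi s r (fun i x => w i x - u0 i x)%R)%E].
Proof. by split => // w h; exact: besov_lower_bound. Qed.

End series_properties.

Theorem rough_field : exists u0 : field R,
  [/\ L2_field u0, div_free u0, (besov_norm chi s r u0 < +oo)%E &
    forall (w : field R) (h : E -> R), L2_field w -> weak_deriv 0 (w 1) h ->
    (1 <= besov_norm chi s r (fun i x => w i x - u0 i x)%R)%E].
Proof. by have [u0 u0P] := series_field; exists u0; exact: rough_series. Qed.

End rough_field.

(** * Small times *)

Section small_times.
Context {R : realType}.
Local Notation E := (R * R * R)%type.
Local Notation mR := (measurableTypeR R).
Local Notation mE := (mR * mR * mR)%type.
Implicit Types (v : field R) (u : R -> field R).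

(* [t |-> grad_sqnorm (u t)] is not known to be measurable; the integral of a
   nonnegative function is then a supremum over simple minorants. *)
Lemma ge0_le_integral_nonmeasurable d (T : measurableType d)
    (mu : {measure set T -> \bar R}) (D : set T) (f g : T -> \bar R) :
  (forall x, D x -> 0 <= f x)%E -> (forall x, D x -> f x <= g x)%E ->
  (\int[mu]_(x in D) f x <= \int[mu]_(x in D) g x)%E.
Proof.
move=> f0 fg; have g0 x : D x -> (0 <= g x)%E.
  by move=> Dx; apply: le_trans (fg _ Dx); exact: f0.
rewrite !ge0_integralE//; apply: le_ereal_sup => _ [h hf <-]; exists h => // x.
apply: le_trans (hf x) _; rewrite /patch; case: ifPn => // Dx.
by apply: fg; rewrite inE in Dx.
Qed.

Lemma weak_deriv_inf_ge0 (j : 'I_3) (f : E -> R) :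
  (0 <= ereal_inf [set (\int[torus]_x (g x ^+ 2)%:E)%E | g in weak_deriv j f])%E.
Proof.
by apply: le_ereal_inf_tmp => _ [g _ <-]; apply: integral_ge0 => x _; rewrite lee_fin sqr_ge0.
Qed.

Lemma grad_sqnorm_ge0 v : (0 <= grad_sqnorm v)%E.
Proof. by apply: sume_ge0 => i _; apply: sume_ge0 => j _; exact: weak_deriv_inf_ge0. Qed.

Lemma grad_sqnorm_weak_deriv v : (grad_sqnorm v < +oo)%E ->
  forall i j : 'I_3, exists h, weak_deriv j (v i) h.
Proof.
move=> voo i j; apply: contrapT => nh; move: voo; apply/negP; rewrite -leNgt.
have inf_y : ereal_inf [set (\int[torus]_x (g x ^+ 2)%:E)%E | g in weak_deriv j (v i)] = +oo%E.
  rewrite -ereal_inf0; congr ereal_inf; apply/seteqP; split=> [y [h hP _]|y []].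
  by apply: nh; exists h.
rewrite -[leLHS]inf_y /grad_sqnorm (bigD1 i)//= (bigD1 j)//= -addeA leeDl//.
rewrite adde_ge0//; apply: sume_ge0 => k _; last first.
  by apply: sume_ge0 => l _; exact: weak_deriv_inf_ge0.
exact: weak_deriv_inf_ge0.
Qed.

(** Otherwise the gradient norm would be infinite on the whole interval from 0 to [eps], and so
    would its time integral. *)
Lemma L2_H1_small_time u (eps : R) : L2_H1 u -> 0 < eps ->
  exists2 t : R, 0 < t < eps & (grad_sqnorm (u t) < +oo)%E.
Proof.
move=> uH1 eps0; apply: contrapT => nt; move: uH1; apply/negP; rewrite -leNgt.
have ut t : 0 < t < eps -> grad_sqnorm (u t) = +oo%E.
  move=> teps; apply/eqP; rewrite -leye_eq leNgt; apply/negP => h.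
  by apply: nt; exists t.
rewrite [leRHS]integral_mkcond.
have <- : (\int[lebesgue_measure]_(t in `]0%R, eps[) cst +oo t = +oo :> \bar R)%E.
  rewrite integral_cst//= lebesgue_measure_itv/= lte_fin eps0 oppr0 adde0.
  by rewrite gt0_mulye// lte_fin.
rewrite [leLHS]integral_mkcond; apply: ge0_le_integral_nonmeasurable => t _.
  by apply: erestrict_ge0 => x _; rewrite leey.
rewrite /patch; case: ifPn => [|_]; rewrite ?inE/= ?in_itv/=.
  by move=> teps; rewrite ut// (_ : t \in _)// inE/= in_itv/= andbT; case/andP: teps.
by case: ifP => // _; exact: grad_sqnorm_ge0.
Qed.

Lemma besov_norm_ge0 chi (s : R) r v : (0 <= besov_norm chi s r v)%E.
Proof.
apply: (@le_trans _ _ ((lambda 0 `^ s)%:E * 'N[torus]_r [EFin \o block_norm chi 0 v])%E).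
  by rewrite mule_ge0 ?Lnorm_ge0// lee_fin powR_ge0.
by apply: ereal_sup_ubound; exists 0.
Qed.

Lemma le_limf_esup_at_right0 (f : R -> \bar R) (c : \bar R) :
  (forall eps, 0 < eps -> exists2 t, 0 < t < eps & (c <= f t)%E) ->
  (c <= limf_esup f (at_right (0 : R)))%E.
Proof.
move=> fc; apply: le_ereal_inf_tmp => _ [V [eps /= eps0 epsV] <-].
have [t /andP[t0 teps] ct] := fc _ eps0; apply: le_trans ct _.
apply: ereal_sup_ubound; exists t => //; apply: epsV => //=.
by rewrite sub0r normrN gtr0_norm.
Qed.

Lemma L2_field0 : L2_field (fun _ (_ : E) => 0 : R).
Proof.
move=> i; split => //; under eq_integral do rewrite expr0n/=.
by rewrite integral0.
Qed.

Lemma div_free0 : div_free (fun _ (_ : E) => 0 : R).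
Proof.
move=> psi _ _; rewrite big1// => i _; under eq_Rintegral do rewrite mul0r.
by rewrite Rintegral_cst// mul0r.
Qed.

Lemma besov_norm0 (chi : E -> R) s (r : \bar R) : besov_cutoff chi -> (0 < r)%E ->
  besov_norm chi s r (fun _ (_ : E) => 0 : R) = 0%E.
Proof.
move=> hchi r0; apply/eqP; rewrite eq_le besov_norm_ge0 andbT.
apply: ge_ereal_sup => _ [q q1 <-].
rewrite (_ : block_norm _ _ _ = cst 0); last first.
  apply/funext => x; rewrite (block_norm_real (w := fun=> fun=> 0)) => [|i].
    by rewrite big1 ?sqrtr0// => i _; rewrite expr0n.
  exact: block0.
by rewrite Lnorm0 ?mule0// gt_eqF.
Qed.

Lemma three_over_le (r : \bar R) : (1 < r)%E -> three_over r <= 3 / 2 -> (2%:E <= r)%E.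
Proof.
case: r => [p| |]//; last by rewrite leey.
rewrite lte_fin lee_fin /= => p1; have p0 : 0 < p by exact: lt_trans p1.
by rewrite ler_pdivrMr//; lra.
Qed.

End small_times.

(** * Choice of the data and conclusion *)

Theorem theorem1p2 (R : realType) (chi : R * R * R -> R)
    (hchi : besov_cutoff chi) :
  exists2 delta : R, 0 < delta &
  forall (mu nu : R) (r : \bar R) (theta gamma : R),
    0 < mu -> 0 < nu ->
    (1 < r)%E -> 3 / 2 < theta <= 2 -> 3 / 2 < gamma -> theta + gamma <= 4 ->
    [/\ gamma <= 5 / 2, 2 <= theta + three_over r < 3
      & gamma + three_over r < 4] \/
    [/\ ((3 / 2)%:E <= r)%E, 3 <= theta + three_over r,
        gamma + three_over r < 4
      & theta + gamma + three_over r <= 11 / 2] ->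
  exists u0 b0 : field R,
    [/\ L2_field u0 /\ L2_field b0,
        div_free u0 /\ div_free b0,
        (besov_norm chi (three_over r + theta - 3) r u0 < +oo)%E,
        (besov_norm chi (three_over r + gamma - 3) r b0 < +oo)%E &
        forall u b : R -> field R, leray_hopf mu nu u0 b0 u b ->
          (delta%:E <=
           limf_esup (fun t : R =>
             besov_norm chi (three_over r + theta - 3) r
               (fun i x => (u t i x - u0 i x)%R)
             + besov_norm chi (three_over r + gamma - 3) r
               (fun i x => (b t i x - b0 i x)%R))
             (at_right (0 : R)))%E].
Proof.
exists 1 => // mu nu r theta gamma _ _ r1 /andP[th1 th2] ga1 _ cases.
set sg := three_over r in cases *; set s := sg + theta - 3.
(* The first case gives [theta + sg < 3]. In the second, [gamma > 3 / 2] turns the bound 11/2 on the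
   full sum into [theta + sg < 4]. *)
have s_lt1 : s < 1.
  by rewrite /s; case: cases => [[_ /andP[_ ?] _]|[_ _ _ ?]]; lra.
(* By [theta > 3 / 2]; this yields [r >= 2], as concentrated packets require. *)
have sg_le : s <= 0 -> sg <= 3 / 2 by rewrite /s; lra.
have [u0 [u02 u0div u0B u0w]] : exists u0 : field R,
    [/\ L2_field u0, div_free u0, (besov_norm chi s r u0 < +oo)%E &
      forall (w : field R) h, L2_field w -> weak_deriv 0 (w 1) h ->
      (1 <= besov_norm chi s r (fun i x => w i x - u0 i x)%R)%E].
  apply: (@rough_field _ _ hchi r s (s <= 0)) => //.
  - by move/sg_le; exact: three_over_le.
  (* The two exponents are [theta - 3 / 2] and [5 / 2 - theta] if [s <= 0], and [s] and [1 - s]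
     otherwise. *)
  - by rewrite -/sg; case: (leP s 0) => s0; rewrite ?mul1r ?mul0r /s in s0 *; lra.
  - by rewrite -/sg; case: (leP s 0) => s0; rewrite ?mul1r ?mul0r; rewrite /s in s_lt1 *; lra.
have r0 : (0 < r)%E by exact: lt_trans r1.
exists u0, (fun _ _ => 0); split.
- by split => //; exact: L2_field0.
- by split => //; exact: div_free0.
- exact: u0B.
- by rewrite besov_norm0.
move=> u b [[u2 _ uH1 _ _] _ _ _].
apply: le_limf_esup_at_right0 => eps eps0.
have [t /andP[t0 teps] /grad_sqnorm_weak_deriv ut] := L2_H1_small_time uH1 eps0.
(* Component 1 has constant polarisation 1, and direction 0 is the one in which all frequencies of
   the probe are large. *)
have [h uth] := ut 1 0; exists t; first by rewrite t0.
apply: (le_trans (u0w _ _ (u2 t (ltW t0)).1 uth)).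
by rewrite leeDl// besov_norm_ge0.
Qed.
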